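(* Let $0\le a<1$ and let $(a_j)_{j\ge2}$ be i.i.d. random variables supported on $[a,1]$. For $N\ge 2$ let $H_N$ be the $N\times N$ symmetric tridiagonal matrix with all diagonal entries equal to $2$ and off-diagonal entries $(H_N)_{j-1,j}=(H_N)_{j,j-1}=-a_j$ for $j=2,\dots,N$. Let $\lambda_N>0$ be the smallest eigenvalue of $H_N$, let $u_N=H_N^{-1}\mathbf 1\in\mathbb R^N$ (where $\mathbf 1$ is the all-ones vector), and $\|u_N\|_\infty=\max_{1\le n\le N}u_N(n)$. (i) If the $a_j$ have the $\{a,1\}$-Bernoulli distribution, i.e. $\mathbb P(a_j=1)=p$ and $\mathbb P(a_j=a)=1-p$ for some $p\in(0,1)$, then almost surely $$\lim_{N\to\infty}\lambda_N\|u_N\|_\infty=\frac{\pi^2}{8}.$$ (ii) If the $a_j$ have the uniform distribution on $[a,1]$, then almost surely $$1\le\liminf_{N\to\infty}\lambda_N\|u_N\|_\infty\le\limsup_{N\to\infty}\lambda_N\|u_N\|_\infty\le\frac{\pi^2}{8}.$$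
   Context: The matrices $H_N$ for different $N$ are all built from the same infinite i.i.d. sequence $(a_j)$, and ''almost surely'' refers to the law of this sequence. $H_N$ is strictly positive definite, and $u_N$ (the landscape function of $H_N$) has strictly positive entries. *)

(* Defs.v *)
From HB Require Import structures.
From mathcomp Require Import all_boot all_order all_algebra.
From mathcomp Require Import all_classical all_reals all_analysis.

Set Implicit Arguments.
Unset Strict Implicit.
Unset Printing Implicit Defensive.

Import Order.TTheory GRing.Theory Num.Theory.
Import numFieldNormedType.Exports.

Local Open Scope classical_set_scope.
Local Open Scope ring_scope.

Section Matrices.
Context {R : realType}.
Implicit Types (c : nat -> R) (N : nat).

(* Indices in 'I_N start at 0: entry (i, j) here is entry (i+1, j+1) of the
   1-based matrix, so the off-diagonal entry at rows/columns {i, i+1} is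
   -c_(i+2). *)
Definition hopping_matrix c N : 'M[R]_N :=
  \matrix_(i, j) if i == j then 2
                 else if (j == i.+1 :> nat) then - c j.+1
                 else if (i == j.+1 :> nat) then - c i.+1
                 else 0.

(* The infimum is a minimum as soon as the (finite) set of real eigenvalues is
   nonempty, which holds for a real symmetric matrix of positive size; see
   smallest_eigenvalueP. *)
Definition smallest_eigenvalue N (A : 'M[R]_N) : R :=
  inf [set l | eigenvalue A l].

Lemma smallest_eigenvalueP N (A : 'M[R]_N) l :
  eigenvalue A l -> (forall m, eigenvalue A m -> l <= m) ->
  smallest_eigenvalue A = l.
Proof.
move=> Al lmin; apply/eqP; rewrite eq_le; apply/andP; split.
  by apply: ge_inf => //; exists l => m /lmin.
by apply: lb_le_inf; [exists l | move=> m /lmin].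
Qed.

(* A^-1 1; note that invmx A = A when A is singular. *)
Definition landscape N (A : 'M[R]_N) : 'cV[R]_N := invmx A *m const_mx 1.

(* mx_norm is the entrywise sup norm max_n |u(n)|. *)
Definition landscape_product c N : R :=
  smallest_eigenvalue (hopping_matrix c N)
  * mx_norm (landscape (hopping_matrix c N)).

End Matrices.

Section RandomSequences.
Context d (T : measurableType d) {R : realType} (P : probability T R).
Implicit Types X : nat -> {RV P >-> R}.

(* The sequence (X_j) is indexed by j >= 2: X 0 and X 1 play no role. *)
Definition independent_from2 X : Prop :=
  forall (s : seq nat) (B : nat -> set R),
    uniq s -> (forall j, j \in s -> (2 <= j)%N) ->
    (forall j, measurable (B j)) ->
    P (\bigcap_(j in [set` s]) (X j @^-1` B j))
    = (\prod_(j <- s) P (X j @^-1` B j))%E.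

Definition identically_distributed_from2 X : Prop :=
  forall i j : nat, (2 <= i)%N -> (2 <= j)%N ->
    forall B : set R, measurable B ->
      distribution P (X i) B = distribution P (X j) B.

Definition iid_from2 X : Prop :=
  independent_from2 X /\ identically_distributed_from2 X.

Definition bernoulli_law (a p : R) (Y : {RV P >-> R}) : Prop :=
  P (Y @^-1` [set 1]) = p%:E /\ P (Y @^-1` [set a]) = (1 - p)%:E.

Definition uniform_law (a b : R) (ab : a < b) (Y : {RV P >-> R}) : Prop :=
  forall B : set R, measurable B -> distribution P Y B = uniform_prob ab B.

End RandomSequences.

(* Main.v *)
Require Import Defs.
From HB Require Import structures.
From mathcomp Require Import all_boot all_order all_algebra.
From mathcomp Require Import all_classical all_reals all_analysis.
From mathcomp Require Import ring lra zify.

(** In both cases the product converges to [pi ^ 2 / 8], which is at least 1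
    because [0 = cos (pi / 2) >= 1 - pi ^ 2 / 8].

    Call an edge free when [1 - a_j] is negligible. At a scale [n] (with a large
    constant [q]) suppose that some run of [q n] consecutive edges is free, and
    that the [1 - a_j] of any [(q + 4) n] consecutive edges add up to at least
    [beta / n].
    - On the free run, a sine and a parabola are a test function for the smallest
      eigenvalue and a subsolution for the landscape: the eigenvalue is at most
      about [pi ^ 2 / (q n) ^ 2] and the sup norm at least about [(q n) ^ 2 / 8].
    - Every bounded nonnegative [v] with [- v'' + (1 - a) v <= g] takes a small
      value in each window of length [(q + 4) n], since otherwise its slope would
      change so much across the window that [v] would become too large nearby.
      Applied to the landscape ([g = 1]) and to the modulus of a ground state
      ([g] the eigenvalue), this confines them up to a small error to intervals
      of length [(q + 4) n + 1] with small boundary values, where comparison with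
      a parabola and a cosine gives the opposite bounds.
    The errors vanish as [q] grows, uniformly in [n]. By Borel-Cantelli, almost
    surely every large [N] admits such a scale [n]: both the absence of a free run
    among the first [N_n] edges and the presence of an unblocked window among the
    first [N_(n+1)] have summable probabilities. *)

Set Implicit Arguments.
Unset Strict Implicit.
Unset Printing Implicit Defensive.

Import Order.TTheory GRing.Theory Num.Theory.
Import numFieldNormedType.Exports.

Local Open Scope classical_set_scope.
Local Open Scope ring_scope.

(** * Trigonometric bounds *)

Section Trigonometry.
Context {R : realType}.
Implicit Types x : R.

Lemma sin_mean_value x : 0 < x -> exists2 c, 0 < c < x & sin x = x * cos c.
Proof.
move=> x0.
have [|c c0x] := @MVT R sin cos 0 x x0 (fun y _ => is_derive_sin y).
  by apply: continuous_subspaceT => y; exact: continuous_sin.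
by rewrite sin0 !subr0 mulrC => ->; exists c.
Qed.

Lemma sin_le x : 0 <= x -> sin x <= x.
Proof.
rewrite le_eqVlt => /predU1P[<-|x0]; first by rewrite sin0.
have [c _ ->] := sin_mean_value x0.
by rewrite ler_piMr ?cos_le1 // ltW.
Qed.

Lemma cosE_half x : cos x = 1 - 2 * sin (x / 2) ^+ 2.
Proof.
have -> : cos x = cos ((x / 2) *+ 2) by congr cos; rewrite -mulr_natr; lra.
by rewrite cos_mulr2n cos2sin2; ring.
Qed.

Lemma cos_ge x : 0 <= x <= pi -> 1 - x ^+ 2 / 2 <= cos x.
Proof.
move=> /andP[x0 xpi]; rewrite cosE_half.
have s0 : 0 <= sin (x / 2) by rewrite sin_ge0_pi //; apply/andP; split; lra.
have sx : sin (x / 2) <= x / 2 by rewrite sin_le //; lra.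
nra.
Qed.

Lemma sqr_pi_ge8 : 8 <= (pi : R) ^+ 2.
Proof.
have p0 : 0 < pi :> R := pi_gt0 R.
have := @cos_ge (pi / 2); rewrite cos_pihalf => /(_ _)/wrap[|h].
  by apply/andP; split; lra.
nra.
Qed.

Lemma sin_ge x : 0 <= x <= pi -> x * (1 - x ^+ 2 / 2) <= sin x.
Proof.
case/andP; rewrite le_eqVlt => /predU1P[<-|x0] xpi; first by rewrite sin0 mul0r.
have [c /andP[c0 cx] ->] := sin_mean_value x0.
rewrite ler_pM2l // (le_trans _ (cos_ge _)) //; first by nra.
by apply/andP; split; lra.
Qed.

(** [2 - 2 * cos x] is the eigenvalue of minus the discrete Laplacian on sines and cosines of
    frequency [x]. This bound and the next compare it with the continuum value [x ^+ 2]. *)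
Lemma cos_gap_le x : 0 <= x <= pi -> 2 - 2 * cos x <= x ^+ 2.
Proof. by move/cos_ge; lra. Qed.

Lemma cos_gap_ge x : 0 <= x <= 2 -> x ^+ 2 * (1 - x ^+ 2 / 4) <= 2 - 2 * cos x.
Proof.
move=> /andP[x0 x2]; rewrite cosE_half.
have p2 : 2 <= pi :> R := pi_ge2 R.
have s1 : x / 2 * (1 - (x / 2) ^+ 2 / 2) <= sin (x / 2).
  by apply: sin_ge; apply/andP; split; lra.
set s := sin _ in s1 *.
have t0 : 0 <= 1 - (x / 2) ^+ 2 / 2 by nra.
have : (x / 2 * (1 - (x / 2) ^+ 2 / 2)) ^+ 2 <= s ^+ 2.
  by rewrite lerXn2r ?nnegrE //; [nra | apply: le_trans s1; nra].
rewrite exprMn.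
have : 1 - x ^+ 2 / 4 <= (1 - (x / 2) ^+ 2 / 2) ^+ 2 by nra.
move=> h1 h2.
have : (x / 2) ^+ 2 * (1 - x ^+ 2 / 4) <= (x / 2) ^+ 2 * (1 - (x / 2) ^+ 2 / 2) ^+ 2.
  by rewrite ler_wpM2l // sqr_ge0.
lra.
Qed.

Lemma sin_rec (t : R) (k : nat) :
  sin (k%:R * t) + sin (k.+2%:R * t) = 2 * cos t * sin (k.+1%:R * t).
Proof.
have -> : k%:R * t = k.+1%:R * t - t by rewrite -(natr1 k); ring.
have -> : k.+2%:R * t = k.+1%:R * t + t by rewrite -(natr1 k.+1); ring.
by rewrite sinB sinD; ring.
Qed.

Lemma cos_rec (t x : R) : cos (x - t) + cos (x + t) = 2 * cos t * cos x.
Proof. by rewrite cosB cosD; ring. Qed.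

End Trigonometry.

(** * Almost convex sequences *)

Section Sequences.
Context {R : realType}.
Implicit Types (v b c f z : nat -> R) (g s M : R).

Lemma second_difference_ge g (a : nat -> R) :
  (forall k, - g <= a k.+2 - 2 * a k.+1 + a k) ->
  forall k, a 0 + k%:R * (a 1 - a 0) - g * (k%:R * (k%:R - 1) / 2) <= a k.
Proof.
move=> ha.
have hd k : a 1 - a 0 - g * k%:R <= a k.+1 - a k.
  by elim: k => [|k IH]; [lra | have := ha k; rewrite -(natr1 k); lra].
elim=> [|k IH]; first by lra.
by have := hd k; rewrite -(natr1 k); lra.
Qed.

Section AlmostConvex.
Variables (v : nat -> R) (g : R).
Hypotheses (g_ge0 : 0 <= g) (v0 : v 0 = 0) (v_ge0 : forall j, 0 <= v j).
Hypothesis v_conv : forall j, - g <= v j.+2 - 2 * v j.+1 + v j.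

Lemma right_ge y k :
  v y + k%:R * (v y.+1 - v y) - g * (k%:R * (k%:R - 1) / 2) <= v (y + k)%N.
Proof.
have := @second_difference_ge g (fun i => v (y + i)%N).
rewrite /= addn0 addn1; apply => i.
by rewrite !addnS; exact: v_conv.
Qed.

(* The bound survives truncation of [y - k], since [v] vanishes at [0]. *)
Lemma left_ge y k :
  v y + k%:R * (v y.-1 - v y) - g * (k%:R * (k%:R - 1) / 2) <= v (y - k)%N.
Proof.
have := @second_difference_ge g (fun i => v (y - i)%N).
rewrite /= subn0 subn1; apply => i.
have [iy|iy] := leqP i.+2 y.
  have := v_conv (y - i.+2).
  have -> : (y - i.+2).+1 = (y - i.+1)%N by lia.
  have -> : (y - i.+1).+1 = (y - i)%N by lia.
  by lra.
have -> : (y - i.+2 = 0)%N by lia.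
have -> : (y - i.+1 = 0)%N by lia.
rewrite v0; have := v_ge0 (y - i); have := g_ge0. lra.
Qed.

(** The extremal case is a parabola of second difference [- g], which rises above a chord of length
    [x1 - x0] by at most [g / 8] times the square of that length. *)
Lemma between_le x0 p x1 s : (x0 <= p <= x1)%N -> v x0 <= s -> v x1 <= s ->
  v p <= s + g * (x1 - x0)%:R ^+ 2 / 8.
Proof.
move=> /andP[x0p px1] hs0 hs1.
have [->|/eqP pn0] := eqVneq p 0.
  rewrite v0; have := v_ge0 x0; have : 0 <= g * (x1 - x0)%:R ^+ 2 by rewrite mulr_ge0 ?sqr_ge0.
  lra.
have := right_ge p (x1 - p); have := left_ge p (p - x0).
have -> : (p - (p - x0) = x0)%N by lia.
have -> : (p + (x1 - p) = x1)%N by lia.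
have := v_conv p.-1; have -> : (p.-1.+1 = p)%N by lia.

have -> : (x1 - x0 = (p - x0) + (x1 - p))%N by lia.
rewrite natrD.
set k' := (p - x0)%:R; set k := (x1 - p)%:R : R.
have : 0 <= k' by []. have : 0 <= k by [].
have [kk0|] := eqVneq (k + k') 0.
  move=> k0 k'0 _ _ h1.
  have kz : k = 0 by lra. have kz' : k' = 0 by lra.
  by move: h1; rewrite kz kz'; lra.
move=> kk0 k0 k'0 hc hl hr.
have kp : 0 < k + k' by rewrite lt_def kk0 addr_ge0.
(* Extrapolating from [p] to [x1] with weight [k'] and to [x0] with weight [k] combines the two
   slopes into [k k'] times the second difference at [p]. The total error is [g k k' (k + k') / 2],
   and [e4] is the inequality [4 k k' <= (k + k')^2]. *)
rewrite -(ler_pM2l kp).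
have e1 : k' * (v p + k * (v p.+1 - v p) - g * (k * (k - 1) / 2)) <= k' * s.
  by rewrite ler_wpM2l // (le_trans hr).
have e2 : k * (v p + k' * (v p.-1 - v p) - g * (k' * (k' - 1) / 2)) <= k * s.
  by rewrite ler_wpM2l // (le_trans hl).
have e3 : k * k' * - g <= k * k' * (v p.+1 - 2 * v p + v p.-1).
  by rewrite ler_wpM2l // mulr_ge0.
have e4 : 0 <= g * (k + k') * (k - k') ^+ 2.
  by rewrite mulr_ge0 ?sqr_ge0 // mulr_ge0 // ltW.
nra.
Qed.

(** If [v] exceeded [s] on the whole window, its slope would grow by about [2 * s * kappa] across
    it. Following the slopes outwards for another [l] sites on both sides would then push [v] above
    [M]. *)
Lemma small_value b M s (N l y : nat) (kappa : R) :
  (forall j, 0 <= b j) -> (forall j, v j <= M) ->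
  (forall j, (j < N)%N ->
     - g + b j.+1 * v j + b j.+2 * v j.+2 <= v j.+2 - 2 * v j.+1 + v j) ->
  (0 < y)%N -> (y + l <= N)%N ->
  kappa <= \sum_(y.+1 <= e < (y + l).+1) b e ->
  M + g * l%:R ^+ 2 < s * kappa * l%:R -> 0 <= s ->
  exists2 j, (y <= j <= y + l)%N & v j <= s.
Proof.
move=> b0 vM hv y0 yl hk hs s0; apply: contrapT => hno.
have big j : (y <= j <= y + l)%N -> s <= v j.
  by move=> hj; rewrite leNgt; apply/negP => hlt; apply: hno; exists j => //; exact: ltW.
(* Each edge inside the window acts on both of its end sites, hence the factor 2. The last term on
   the left is the half already contributed by the edge that leaves the current site to the
   right. *)
have key i : (i <= l)%N ->
    - g * i.+1%:R + 2 * s * \sum_(y.+1 <= e < (y + i).+1) b e + b (y + i).+1 * v (y + i).+1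
    <= (v (y + i).+1 - v (y + i)%N) - (v y - v y.-1).
  elim: i => [_|i IH il].
    rewrite addn0 big_geq //.
    have /hv : (y.-1 < N)%N by lia.
    have -> : (y.-1.+1 = y)%N by lia.

    by have := mulr_ge0 (b0 y) (v_ge0 y.-1); lra.
  have := IH (ltnW il).
  have -> : (y + i.+1 = (y + i).+1)%N by lia.
  rewrite [X in _ -> _ + _ * X + _ <= _]big_nat_recr /=; last by lia.
  have /hv : (y + i < N)%N by lia.
  have h1 : b (y + i).+1 * s <= b (y + i).+1 * v (y + i)%N.
    by rewrite ler_wpM2l // big //; lia.
  have h2 : b (y + i).+1 * s <= b (y + i).+1 * v (y + i).+1.
    by rewrite ler_wpM2l // big //; lia.
  rewrite -(natr1 i.+1); lra.
have h1 := key l (leqnn l).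
have h2 := right_ge (y + l) l.
have h3 := left_ge y l.
have h4 := vM (y + l + l)%N.
have h5 := vM (y - l)%N.
have h6 : s <= v y by rewrite big // leqnn leq_addr.
have h7 : s <= v (y + l)%N by rewrite big // leqnn leq_addr.
have h8 := mulr_ge0 (b0 (y + l).+1) (v_ge0 (y + l).+1).
have h9 : s * kappa <= s * \sum_(y.+1 <= e < (y + l).+1) b e by rewrite ler_wpM2l.
have h10 : - g * l.+1%:R + 2 * (s * kappa) <= (v (y + l).+1 - v (y + l)%N) - (v y - v y.-1) by lra.
have h11 : l%:R * (- g * l.+1%:R + 2 * (s * kappa)) <=
    l%:R * ((v (y + l).+1 - v (y + l)%N) - (v y - v y.-1)).
  by rewrite ler_wpM2l.
move: h11; rewrite -(natr1 l); nra.
Qed.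

End AlmostConvex.

(** Take for [x0] the last small value up to [p]. The window that starts just after [x0] contains
    another one, which lies beyond [p] by maximality; if the window sticks out past [N], its right
    end is already a zero of [v]. The first step out of [x0] accounts for [l.+1]. *)
Lemma small_values_around v s (N l p : nat) : v 0 = 0 -> 0 <= s ->
  (forall j, (N < j)%N -> v j = 0) ->
  (forall y, (0 < y)%N -> (y + l <= N)%N -> exists2 j, (y <= j <= y + l)%N & v j <= s) ->
  exists x0 x1, [/\ (x0 <= p <= x1)%N, (x1 - x0 <= l.+1)%N, v x0 <= s & v x1 <= s].
Proof.
move=> v0 s0 vN hw.
have [ps|ps] := leP (v p) s; first by exists p, p; split => //; lia.
pose P j := (j <= p)%N && (v j <= s).
have exP : exists j, P j by exists 0%N; rewrite /P v0 s0.
have bP j : P j -> (j <= p)%N by case/andP.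
case: (ex_maxnP exP bP) => x0 /andP[x0p x0s] x0max.
have pN : (p <= N)%N.
  by rewrite leqNgt; apply/negP => /vN vp; move: ps; rewrite vp ltNge s0.
have [hN|hN] := leqP (x0.+1 + l) N.
  have [//|j jr js] := hw x0.+1 _ hN.
  have pj : (p < j)%N.
    by rewrite ltnNge; apply/negP => jp; have := x0max j; rewrite /P jp js => /(_ isT); lia.
  by exists x0, j; split => //; lia.
exists x0, (x0.+1 + l)%N; split => //; [lia|lia|by rewrite vN].
Qed.

(** Maximum principle: at an interior maximum of [f / z] with value above [t], the inequality for
    [f] is incompatible with the strict inequality for the positive [z]. *)
Lemma comparison c f z lam t (x0 x1 : nat) : (x0 <= x1)%N -> 0 <= t ->
  (forall j, 0 <= c j) ->
  (forall j, (x0 <= j <= x1)%N -> 0 < z j) ->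
  (forall j, (x0 <= j)%N -> (j.+2 <= x1)%N ->
     2 * f j.+1 - c j.+1 * f j - c j.+2 * f j.+2 <= lam * f j.+1) ->
  (forall j, (x0 <= j)%N -> (j.+2 <= x1)%N ->
     lam * z j.+1 < 2 * z j.+1 - c j.+1 * z j - c j.+2 * z j.+2) ->
  f x0 <= t * z x0 -> f x1 <= t * z x1 ->
  forall j, (x0 <= j <= x1)%N -> f j <= t * z j.
Proof.
move=> x01 t0 c0 zp hf hz hx0 hx1 j hj.
pose F (i : 'I_(x1 - x0).+1) := f (x0 + i)%N / z (x0 + i)%N.
case: (@arg_maxP _ _ _ ord0 xpredT F isT) => i _ imax.
have rmax k : (x0 <= k <= x1)%N -> f k <= F i * z k.
  move=> hk; have hk' : (k - x0 < (x1 - x0).+1)%N by lia.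
  have : F (Ordinal hk') <= F i := imax _ isT.
  have -> : F (Ordinal hk') = f k / z k by rewrite /F /=; congr (f _ / z _); lia.
  by rewrite ler_pdivrMr //; exact: zp.
have [rt|tr] := leP (F i) t.
  by rewrite (le_trans (rmax _ hj)) // ler_wpM2r // ltW // zp.
set r := F i in tr rmax.
set q := (x0 + i)%N; have qr : (x0 <= q <= x1)%N by have := ltn_ord i; rewrite /q; lia.
have fq : f q = r * z q by rewrite /r /F -/q divfK // gt_eqF // zp.
have q0 : q != x0.
  apply/eqP => qx; move: hx0; rewrite -qx fq ler_pM2r ?zp // leNgt tr //.
have q1 : q != x1.
  apply/eqP => qx; move: hx1; rewrite -qx fq ler_pM2r ?zp // leNgt tr //.
have qn0 : (q.-1.+1 = q)%N by lia.
have := hf q.-1; have := hz q.-1; rewrite qn0.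
move=> /(_ _ _)/wrap[||hz']; [lia|lia|].
move=> /(_ _ _)/wrap[||hf']; [lia|lia|].
have r0 : 0 < r by exact: le_lt_trans tr.
have hm1 : c q * f q.-1 <= c q * (r * z q.-1) by rewrite ler_wpM2l // rmax //; lia.
have hp1 : c q.+1 * f q.+1 <= c q.+1 * (r * z q.+1) by rewrite ler_wpM2l // rmax //; lia.
have : r * (lam * z q) < r * (2 * z q - c q * z q.-1 - c q.+1 * z q.+1) by rewrite ltr_pM2l.
by move: hf'; rewrite fq; lra.
Qed.

(** Otherwise a cosine of frequency [th] centred at the midpoint is a strict supersolution. Its
    values on the interval are at least [C], so comparison with [s / C] times it gives
    [v p <= s / C < 1]. *)
Lemma cos_gap_le_of_decay (v : nat -> R) lam th s (x0 p x1 m : nat) :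
  0 <= lam ->
  (forall j, 2 * v j.+1 - v j - v j.+2 <= lam * v j.+1) ->
  (x0 <= p <= x1)%N -> (x1 - x0 <= m)%N ->
  v x0 <= s -> v x1 <= s -> 0 <= s -> v p = 1 ->
  0 <= th -> th * m%:R <= pi -> s < cos (th * m%:R / 2) ->
  2 - 2 * cos th <= lam.
Proof.
move=> lam0 hv /andP[x0p px1] hm hs0 hs1 s0 vp th0 thm hs.
rewrite leNgt; apply/negP => hlam.
pose mid : R := (x0%:R + x1%:R) / 2.
pose z j := cos (th * (j%:R - mid)).
have C0 : 0 < cos (th * m%:R / 2) by exact: le_lt_trans hs.
set C := cos _ in hs C0.
have m0 : 0 <= m%:R :> R by [].
have zC j : (x0 <= j <= x1)%N -> C <= z j.
  move=> /andP[h0 h1]; rewrite /z /C -[cos (th * (_ - _))]cos_norm.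
  have a0 : 0 <= th * m%:R / 2 by rewrite divr_ge0 // mulr_ge0.
  have ale : `|th * (j%:R - mid)| <= th * m%:R / 2.
    rewrite normrM (ger0_norm th0) -mulrA ler_wpM2l //.
    have : x0%:R <= j%:R :> R by rewrite ler_nat.
    have : j%:R <= x1%:R :> R by rewrite ler_nat.
    have : x1%:R <= x0%:R + m%:R :> R by rewrite -natrD ler_nat -leq_subLR.
    by rewrite /mid ler_norml => *; apply/andP; split; lra.
  move: ale; rewrite le_eqVlt => /predU1P[->//|alt].
  have p0 := pi_ge0 R.
  rewrite ltW // ltr_cos // in_itv /= ?a0 ?normr_ge0 /=; lra.
have x01 : (x0 <= x1)%N by exact: leq_trans x0p px1.
have := @comparison (fun=> 1) v z lam (s / C) x0 x1 x01.
move=> /(_ _ _ _ _ _ _ _ p)/wrap[].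
- by rewrite divr_ge0 // ltW.
- by move=> _; exact: ler01.
- by move=> j /zC; exact: lt_le_trans.
- by move=> j _ _; rewrite !mul1r; exact: hv.
- move=> j hj0 hj1; rewrite !mul1r.
  have := cos_rec th (th * (j.+1%:R - mid)).
  have -> : th * (j.+1%:R - mid) - th = th * (j%:R - mid) by rewrite -(natr1 j); ring.
  have -> : th * (j.+1%:R - mid) + th = th * (j.+2%:R - mid) by rewrite -(natr1 j.+1); ring.
  rewrite -/(z j) -/(z j.+1) -/(z j.+2) => e.
  have zj : 0 < z j.+1 by apply: lt_le_trans (zC _ _); rewrite // (leqW hj0) (ltnW hj1).
  have : lam * z j.+1 < (2 - 2 * cos th) * z j.+1 by rewrite ltr_pM2r.
  lra.
- by rewrite (le_trans hs0) // mulrAC ler_pdivlMr // ler_wpM2l // zC // leqnn.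
- by rewrite (le_trans hs1) // mulrAC ler_pdivlMr // ler_wpM2l // zC // leqnn andbT.
rewrite vp x0p px1 => /(_ isT) h.
have zp1 : z p <= 1 by exact: cos_le1.
have : s / C * z p <= s / C by rewrite ler_piMr // divr_ge0 // ltW.
have : s / C < 1 by rewrite ltr_pdivrMr // mul1r.
lra.
Qed.

End Sequences.

(** * Rayleigh quotients *)

Section Rayleigh.
Context {R : realType}.

Lemma continuous_sumr (T : topologicalType) (I : Type) (r : seq I)
    (F : I -> T -> R) :
  (forall i, continuous (F i)) -> continuous (fun x => \sum_(i <- r) F i x).
Proof.
move=> cF; elim: r => [|i r IH] x.
  under eq_fun do rewrite big_nil; exact: cst_continuous.
under eq_fun do rewrite big_cons; exact: (continuousD (cF i x) (IH x)).
Qed.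

Lemma continuous_form n (A : 'M[R]_n) :
  continuous (fun x : 'rV[R]_n => (x *m A *m x^T) 0 0).
Proof.
have -> : (fun x : 'rV[R]_n => (x *m A *m x^T) 0 0) =
    (fun x => \sum_i (\sum_j x 0 j * A j i) * x 0 i).
  by apply/funext => x; rewrite mxE; apply: eq_bigr => i _; rewrite !mxE.
apply: continuous_sumr => i x; apply: continuousM; last exact: coord_continuous.
apply: continuous_sumr => j {}x; apply: continuousM; first exact: coord_continuous.
exact: cst_continuous.
Qed.

Lemma sqr_norm_rV n (x : 'rV[R]_n) : (x *m x^T) 0 0 = \sum_i x 0 i ^+ 2.
Proof. by rewrite mxE; apply: eq_bigr => i _; rewrite mxE expr2. Qed.

(** The quadratic form attains its minimum on the compact Euclidean unit sphere, and a minimiser is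
    an eigenvector by a first-order variation. *)
Lemma Rayleigh_min n (A : 'M[R]_n) : (0 < n)%N -> A^T = A ->
  exists l (x : 'rV[R]_n), [/\ x != 0, x *m A = l *: x &
    forall y : 'rV[R]_n, l * (y *m y^T) 0 0 <= (y *m A *m y^T) 0 0].
Proof.
move=> n0 symA.
pose q (x : 'rV[R]_n) : R := (x *m A *m x^T) 0 0.
pose nn (x : 'rV[R]_n) : R := (x *m x^T) 0 0.
pose S := [set x | nn x = 1].
have nnE x : nn x = \sum_i x 0 i ^+ 2 by rewrite /nn sqr_norm_rV.
have cS : compact S.
  apply: bounded_closed_compact.
    exists 1; split; first by rewrite num_real.
    move=> M M1 x /= xS; rewrite /Num.norm /= mx_normrE.
    apply/bigmax_leP; split => [|[i j] _ /=]; first by lra.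
    rewrite (ord1 i); apply: le_trans (ltW M1).
    rewrite -(@expr_le1 _ 2) // -normrX ger0_norm ?sqr_ge0 //.
    rewrite -xS nnE (bigD1 j) //= lerDl sumr_ge0 // => k _; exact: sqr_ge0.
  have -> : S = nn @^-1` [set 1] by [].
  apply: preimage_closed; last exact: closed_eq.
  move=> x _; have := @continuous_form n 1%:M x.
  by under eq_fun do rewrite mulmx1.
have S0 : S !=set0.
  exists (delta_mx 0 (Ordinal n0)); rewrite /S /= /nn trmx_delta mul_delta_mx.
  by rewrite mxE !eqxx.
have [x xS xmin] := EVT_min_rV S0 cS (continuous_subspaceT (@continuous_form n A)).
rewrite inE /S /= in xS.
have nn0 y : y != 0 -> 0 < nn y.
  move=> /eqP y0; rewrite nnE lt_def sumr_ge0 ?andbT => [|i _]; last exact: sqr_ge0.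
  apply/eqP => /eqP; rewrite psumr_eq0 => [/allP h|i _]; last exact: sqr_ge0.
  apply: y0; apply/rowP => i; rewrite mxE; apply/eqP; rewrite -sqrf_eq0.
  by apply: h; rewrite mem_index_enum.
have qZ a y : q (a *: y) = a ^+ 2 * q y.
  by rewrite /q linearZ /= -!scalemxAl -scalemxAr scalerA mxE expr2.
have nnZ a y : nn (a *: y) = a ^+ 2 * nn y.
  by rewrite /nn linearZ /= -!scalemxAl -scalemxAr scalerA mxE expr2.
pose l := q x.
have ray y : l * nn y <= q y.
  have [->|y0] := eqVneq y 0; first by rewrite /nn /q !mul0mx !mxE mulr0.
  have sq : Num.sqrt (nn y) ^+ 2 = nn y by rewrite sqr_sqrtr // ltW // nn0.
  have nny : nn ((Num.sqrt (nn y))^-1 *: y) = 1.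
    by rewrite nnZ exprVn sq mulVf ?gt_eqF ?nn0.
  have : q x <= q ((Num.sqrt (nn y))^-1 *: y) by apply: xmin; rewrite inE.
  by rewrite qZ exprVn sq ler_pdivlMl ?nn0 // mulrC.
exists l, x; split => //.
  by apply/eqP => x0; move: xS; rewrite /nn x0 mul0mx mxE => /esym/eqP; rewrite oner_eq0.
(* [q - l nn] is a nonnegative form vanishing at [x], so [x] is in its kernel. *)
have key (y : 'rV[R]_n) : ((x *m A - l *: x) *m y^T) 0 0 = 0.
  have symB : (y *m A *m x^T) 0 0 = (x *m A *m y^T) 0 0.
    have : (y *m A *m x^T)^T = x *m A *m y^T by rewrite !trmx_mul trmxK symA mulmxA.
    by move/matrixP/(_ 0 0); rewrite mxE.
  have symI : (y *m x^T) 0 0 = (x *m y^T) 0 0.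
    have : (y *m x^T)^T = x *m y^T by rewrite trmx_mul trmxK.
    by move/matrixP/(_ 0 0); rewrite mxE.
  have mxD (M1 M2 : 'M[R]_1) : (M1 + M2) 0 0 = M1 0 0 + M2 0 0 by rewrite mxE.
  have mxZ a (M1 : 'M[R]_1) : (a *: M1) 0 0 = a * M1 0 0 by rewrite mxE.
  have mxN (M1 : 'M[R]_1) : (- M1) 0 0 = - M1 0 0 by rewrite mxE.
  set b := LHS.
  have bE : b = (x *m A *m y^T) 0 0 - l * (x *m y^T) 0 0.
    by rewrite /b mulmxBl mxD mxN -scalemxAl mxZ.
  have exp t : q (x + t *: y) - l * nn (x + t *: y)
      = 2 * t * b + t ^+ 2 * (q y - l * nn y).
    rewrite bE /q /nn linearD linearZ /= !(mulmxDl, mulmxDr).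
    rewrite -!(scalemxAl, scalemxAr) !(mxD, mxZ) symB symI.
    have -> : (x *m x^T) 0 0 = 1 by [].
    have -> : (x *m A *m x^T) 0 0 = l by [].
    ring.
  have hq t : 0 <= 2 * t * b + t ^+ 2 * (q y - l * nn y).
    by rewrite -exp subr_ge0 ray.
  have Q0 : 0 <= q y - l * nn y by rewrite subr_ge0 ray.
  set Q := q y - _ in hq Q0.
  have Q1 : 0 < Q + 1 by lra.
  (* This [t] makes the quadratic negative unless [b = 0]. Dividing by [Q + 1] rather than by the
     minimising [Q] covers the case [Q = 0]. *)
  have := hq (- (b / (Q + 1))).
  have -> : 2 * - (b / (Q + 1)) * b + (- (b / (Q + 1))) ^+ 2 * Q
      = - (b ^+ 2 * ((Q + 2) / (Q + 1) ^+ 2)) by field; rewrite gt_eqF.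
  rewrite oppr_ge0 pmulr_lle0; last by rewrite divr_gt0 ?exprn_gt0 // ltr_wpDl.
  by move=> b2; apply/eqP; rewrite -sqrf_eq0 eq_le b2 sqr_ge0.
apply/eqP; rewrite -subr_eq0; apply/eqP/rowP => i; rewrite [RHS]mxE.
have := key (delta_mx 0 i); rewrite trmx_delta.
by rewrite -colE mxE.
Qed.

End Rayleigh.

(** * Hopping matrices *)

Section HoppingMatrix.
Context {R : realType}.
Implicit Types (c : nat -> R) (N : nat).

Lemma eq_hopping_matrix c c' N : (forall j, (2 <= j)%N -> c j = c' j) ->
  hopping_matrix c N = hopping_matrix c' N.
Proof.
move=> cc'; apply/matrixP => i j; rewrite !mxE.
case: ifP => // _; case: ifP => [/eqP ij|_].
  by rewrite cc' // ij.
by case: ifP => // /eqP ij; rewrite cc' // ij.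
Qed.

Lemma tr_hopping_matrix c N : (hopping_matrix c N)^T = hopping_matrix c N.
Proof.
apply/matrixP => i j; rewrite !mxE eq_sym; case: ifP => // _.
by do 2 case: ifP => //; move=> /eqP h1 /eqP h2; lia.
Qed.

(* Sites are numbered from 1, so that the boundary condition sits at [0] and
   [N + 1], and the edge between the sites [j - 1] and [j] carries [c j]. *)
Definition zero_extend N (x : 'I_N -> R) (n : nat) : R :=
  if n is k.+1 then oapp x 0 (insub k) else 0.
Arguments zero_extend : simpl never.

Lemma zero_extendE N (x : 'I_N -> R) (i : 'I_N) : zero_extend x i.+1 = x i.
Proof. by rewrite /zero_extend valK. Qed.

Lemma zero_extend_out N (x : 'I_N -> R) n : (N < n)%N -> zero_extend x n = 0.
Proof. by case: n => // n Nn; rewrite /zero_extend insubF //; apply/negbTE; lia. Qed.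

Lemma zero_extendK N (f : nat -> R) n : f 0 = 0 -> (forall j, (N < j)%N -> f j = 0) ->
  zero_extend (fun i : 'I_N => f i.+1) n = f n.
Proof.
case: n => [//|n] f0 fN; rewrite /zero_extend; case: insubP => [i _ <- //|nN] /=.
by rewrite fN //; lia.
Qed.

Lemma sum_ord_eq_zero_extend N (x F : nat -> R) (y : 'I_N -> R) k :
  (forall j : 'I_N, j = k :> nat -> x j = F k) ->
  \sum_(j < N | j == k :> nat) x j * y j = F k * zero_extend y k.+1.
Proof.
move=> hx; have [kN|Nk] := ltnP k N.
  rewrite (big_pred1 (Ordinal kN)) => [|j]; last by [].
  by rewrite (hx (Ordinal kN)) // -(zero_extendE y (Ordinal kN)).
rewrite zero_extend_out // mulr0 big_pred0 // => j.
by have := ltn_ord j; lia.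
Qed.

Lemma hopping_matrixE c N (x : 'I_N -> R) (i : 'I_N) :
  \sum_j hopping_matrix c N i j * x j =
  2 * zero_extend x i.+1 - c i.+1 * zero_extend x i - c i.+2 * zero_extend x i.+2.
Proof.
have -> : \sum_j hopping_matrix c N i j * x j =
    \sum_(j < N) ((if j == i :> nat then 2 * x j else 0)
      + (if j == i.+1 :> nat then - c j.+1 * x j else 0)
      + (if (j.+1 == i :> nat) then - c i.+1 * x j else 0)).
  apply: eq_bigr => j _; rewrite mxE -val_eqE /= [_ == val j]eq_sym.
  rewrite [_ == j.+1]eq_sym.
  case: (eqVneq (j : nat) i) => [h|h]; case: (eqVneq (j : nat) i.+1) => [h1|h1];
    case: (eqVneq j.+1 i) => [h2|h2]; try lia;
    rewrite ?mul0r ?add0r ?addr0 //.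
rewrite !big_split -!big_mkcond /=.
rewrite (@sum_ord_eq_zero_extend _ (fun=> 2) (fun=> 2) x i) //.
rewrite (@sum_ord_eq_zero_extend _ (fun j => - c j.+1) (fun j => - c j.+1) x i.+1) //; last first.
  by move=> j ->.
have -> : \sum_(j < N | j.+1 == i :> nat) - c i.+1 * x j = - c i.+1 * zero_extend x i.
  case: i => -[|i] iN /=; first by rewrite mulr0 big_pred0.
  exact: (@sum_ord_eq_zero_extend _ (fun=> - c i.+2) (fun=> - c i.+2) x i).
by ring.
Qed.

Lemma mx_norm_ge0 m n (A : 'M[R]_(m, n)) : 0 <= mx_norm A.
Proof. by rewrite mx_normE. Qed.

Section Bounded.
Variables (c : nat -> R) (N : nat).
Hypotheses (N_gt0 : (0 < N)%N) (c_ge0 : forall j, 0 <= c j) (c_le1 : forall j, c j <= 1).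
Local Notation H := (hopping_matrix c N).

Lemma minimum_principle (f : nat -> R) : f 0 <= 0 -> f N.+1 <= 0 ->
  (forall j, (j < N)%N -> 2 * f j.+1 - c j.+1 * f j - c j.+2 * f j.+2 <= 0) ->
  forall j, (j <= N.+1)%N -> f j <= 0.
Proof.
move=> f0 fN hf j jN.
(* A concave parabola, positive on all of [[0, N + 1]] and of constant second difference -2: a
   strict supersolution whatever [c] in [[0, 1]] is. *)
pose z (j : nat) : R := (j%:R + 1) * (N%:R + 2 - j%:R).
have zp k : (0 <= k <= N.+1)%N -> 0 < z k.
  case/andP=> _; rewrite -(ler_nat R) -natr1 => kN.
  by apply: mulr_gt0; [exact: ltr_wpDl | lra].
rewrite -[leRHS](mul0r (z j)).
apply: (@comparison R c f z 0 0 0 N.+1 (leq0n _) (lexx _) c_ge0 zp);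
  rewrite ?mul0r //.
- by move=> k _ kN; rewrite mul0r; exact: hf.
- move=> k _ kN; rewrite mul0r.
  have h0 : c k.+1 * z k <= z k by rewrite ler_piMl // ltW // zp //; lia.
  have h2 : c k.+2 * z k.+2 <= z k.+2 by rewrite ler_piMl // ltW // zp //; lia.
  have : 2 * z k.+1 - z k - z k.+2 = 2 by rewrite /z -(natr1 k.+1) -(natr1 k); ring.
  lra.
Qed.

(** The minimum principle, applied to a kernel vector and to its opposite, forces that vector to
    vanish. *)
Lemma hopping_matrix_unit : H \in unitmx.
Proof.
rewrite unitmxE unitfE; apply/negP => /det0P[v /eqP v0 vH]; apply: v0.
have vH' (i : 'I_N) : 2 * zero_extend (v 0) i.+1 - c i.+1 * zero_extend (v 0) i
    - c i.+2 * zero_extend (v 0) i.+2 = 0.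
  rewrite -hopping_matrixE; move/matrixP/(_ 0 i): vH; rewrite !mxE => vH.
  rewrite -[RHS]vH; apply: eq_bigr => j _.
  by rewrite -[in RHS]tr_hopping_matrix [in RHS]mxE mulrC.
have le0 := @minimum_principle (zero_extend (v 0)).
have ge0 := @minimum_principle (fun j => - zero_extend (v 0) j).
apply/rowP => i; rewrite mxE; apply/eqP; rewrite eq_le -oppr_le0.
rewrite -(zero_extendE (v 0)); apply/andP; split.
  apply: le0 => [//||j jN|]; [by rewrite zero_extend_out| |exact: ltnW (ltn_ord i)].
  by have := vH' (Ordinal jN) => /= ->.
apply: ge0 => [||j jN|]; [by rewrite oppr0|by rewrite zero_extend_out ?oppr0|
  |exact: ltnW (ltn_ord i)].
by have := vH' (Ordinal jN) => /= e; lra.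
Qed.

Definition landscape_seq := zero_extend (fun i => landscape H i 0).
Local Notation u := landscape_seq.

Lemma landscape_seqE j : (j < N)%N ->
  2 * u j.+1 - c j.+1 * u j - c j.+2 * u j.+2 = 1.
Proof.
move=> jN; have := hopping_matrixE c (fun i => landscape H i 0) (Ordinal jN).
move=> /= <-; have : (H *m landscape H) (Ordinal jN) 0 = 1.
  by rewrite /landscape mulKVmx ?hopping_matrix_unit // mxE.
by rewrite mxE.
Qed.

Lemma landscape_seq_out j : (N < j)%N -> u j = 0.
Proof. exact: zero_extend_out. Qed.

Lemma landscape_seq_ge0 j : 0 <= u j.
Proof.
have [jN|Nj] := leqP j N; last by rewrite landscape_seq_out.
rewrite -oppr_le0; apply: (@minimum_principle (fun j => - u j)).
- by rewrite oppr0.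
- by rewrite landscape_seq_out ?oppr0.
- by move=> k kN; have := landscape_seqE kN; lra.
- by lia.
Qed.

Lemma landscape_seq_le j : u j <= mx_norm (landscape H).
Proof.
have [->|j0] := posnP j; first exact: mx_norm_ge0.
have [jN|Nj] := leqP j N; last by rewrite landscape_seq_out // mx_norm_ge0.
have jN' : (j.-1 < N)%N by lia.
have -> : u j = landscape H (Ordinal jN') 0.
  by rewrite -(zero_extendE (fun i => landscape H i 0)) /= prednK.
rewrite mx_normrE; apply: le_trans (ler_norm _) _.
exact: (le_bigmax _ (fun ij : 'I_N * 'I_1 => `|landscape H ij.1 ij.2|) (Ordinal jN', 0)).
Qed.

Lemma landscape_norm_attained : exists p, u p = mx_norm (landscape H).
Proof.
have [M0|/mx_norm_neq0[[i j] /= M]] := eqVneq (mx_norm (landscape H)) 0.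
  by exists 0%N; rewrite M0.
exists i.+1; rewrite M (ord1 j) /u zero_extendE ger0_norm //.
rewrite -(zero_extendE (fun i => landscape H i 0)). exact: (landscape_seq_ge0 i.+1).
Qed.

(** The first half supplies a nonnegative subsolution of sup norm 1, namely the normalised modulus
    of an eigenvector. The second turns pointwise inequalities for a nonnegative test function,
    required only where it is nonzero, into an upper bound on the eigenvalue. *)
Lemma ground_state : exists v : nat -> R,
  [/\ 0 <= smallest_eigenvalue H,
      v 0 = 0 /\ (forall j, (N < j)%N -> v j = 0),
      forall j, 0 <= v j <= 1,
      exists p, v p = 1 &
      forall j, (j < N)%N -> 2 * v j.+1 - c j.+1 * v j - c j.+2 * v j.+2
         <= smallest_eigenvalue H * v j.+1]
  /\ (forall f : nat -> R, (forall j, 0 <= f j) -> (exists p, f p != 0) ->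
      f 0 = 0 -> (forall j, (N < j)%N -> f j = 0) ->
      forall mu, (forall j, (j < N)%N -> f j.+1 != 0 ->
         2 * f j.+1 - c j.+1 * f j - c j.+2 * f j.+2 <= mu * f j.+1) ->
      smallest_eigenvalue H <= mu).
Proof.
have [l [x [x0 xH ray]]] := Rayleigh_min N_gt0 (tr_hopping_matrix c N).
have minl m : eigenvalue H m -> l <= m.
  case/eigenvalueP => y yH y0.
  have : 0 < (y *m y^T) 0 0.
    rewrite sqr_norm_rV lt_def sumr_ge0 ?andbT => [|i _]; last exact: sqr_ge0.
    rewrite psumr_eq0 => [|i _]; last exact: sqr_ge0.
    apply: contra_neqN y0 => /allP h; apply/rowP => i; rewrite mxE.
    by apply/eqP; rewrite -sqrf_eq0; apply: h; rewrite mem_index_enum.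
  move=> yp; rewrite -(ler_pM2r yp) (le_trans (ray y)) //.
  by rewrite yH -scalemxAl mxE.
have -> : smallest_eigenvalue H = l.
  by apply: smallest_eigenvalueP => //; apply/eigenvalueP; exists x.
pose f := zero_extend (x 0).
have fE (j : nat) : (j < N)%N -> 2 * f j.+1 - c j.+1 * f j - c j.+2 * f j.+2 = l * f j.+1.
  move=> jN; have := hopping_matrixE c (x 0) (Ordinal jN) => /= <-.
  move/matrixP/(_ 0 (Ordinal jN)): xH; rewrite !mxE.
  have -> : f j.+1 = x 0 (Ordinal jN) by rewrite -(zero_extendE (x 0)).
  move=> <-; apply: eq_bigr => k _.
  by rewrite -[in LHS]tr_hopping_matrix [in LHS]mxE mulrC.
(* Kato's inequality: taking absolute values in the eigenvalue equation keeps an inequality because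
   the hoppings are nonnegative. *)
have Kato j : (j < N)%N ->
    2 * `|f j.+1| - c j.+1 * `|f j| - c j.+2 * `|f j.+2| <= l * `|f j.+1|.
  move=> jN; have e := fE _ jN.
  have : `|(2 - l) * f j.+1| <= c j.+1 * `|f j| + c j.+2 * `|f j.+2|.
    have -> : (2 - l) * f j.+1 = c j.+1 * f j + c j.+2 * f j.+2 by lra.
    by rewrite (le_trans (ler_normD _ _)) // !normrM !(ger0_norm (c_ge0 _)).
  rewrite normrM.
  have : (2 - l) * `|f j.+1| <= `|2 - l| * `|f j.+1| by rewrite ler_wpM2r // ler_norm.
  lra.
(* With [l < 0] the modulus would satisfy the hypotheses of the minimum principle, hence vanish. *)
have l0 : 0 <= l.
  rewrite leNgt; apply/negP => l0; move/eqP: x0; apply; apply/rowP => i.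
  rewrite mxE; apply/eqP; rewrite -normr_le0 -(zero_extendE (x 0)).
  apply: (@minimum_principle (fun j => `|f j|) _ _ _ i.+1).
  - by rewrite normr0.
  - by rewrite /f zero_extend_out ?normr0.
  - by move=> j jN; rewrite (le_trans (Kato _ jN)) // nmulr_rle0.
  - exact: ltnW (ltn_ord i).
have nx : mx_norm x != 0.
  by apply: contra_neq x0; exact: mx_norm_eq0.
have nxp : 0 < mx_norm x by rewrite lt_def nx; exact: mx_norm_ge0.
exists (fun j => `|f j| / mx_norm x); split.
  split => //.
  - split => [|j jN]; first by rewrite normr0 mul0r.
    by rewrite /f zero_extend_out // normr0 mul0r.
  - move=> j; rewrite divr_ge0 ?(ltW nxp) //= ler_pdivrMr // mul1r.
    have [jN|Nj] := leqP j N; last by rewrite /f zero_extend_out // normr0 ltW.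
    have [->|j0] := posnP j; first by rewrite normr0 ltW.
    have jN' : (j.-1 < N)%N by lia.
    have -> : f j = x 0 (Ordinal jN') by rewrite -(zero_extendE (x 0)) /= prednK.
    rewrite mx_normrE.
    exact: (le_bigmax _ (fun ij : 'I_1 * 'I_N => `|x ij.1 ij.2|) (0, Ordinal jN')).
  - have [[i j] /= M] := mx_norm_neq0 nx.
    by exists j.+1; rewrite /f zero_extendE -(ord1 i) M divff // -M.
  - move=> j jN; have := Kato j jN.
    by rewrite -(ler_pM2r (_ : 0 < (mx_norm x)^-1)) ?invr_gt0 //; lra.
move=> g g0 [p gp] gz gN mu hmu.
have gK n : zero_extend (fun i : 'I_N => g i.+1) n = g n by exact: zero_extendK.
pose y : 'rV[R]_N := \row_i g i.+1.
have := ray y; rewrite sqr_norm_rV.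
have yp : 0 < \sum_i y 0 i ^+ 2.
  rewrite lt_def sumr_ge0 ?andbT => [|i _]; last exact: sqr_ge0.
  rewrite psumr_eq0 => [|i _]; last exact: sqr_ge0.
  apply: contra_neqN gp => /allP h.
  have [->//|p0] := posnP p.
  have [pN|/gN//] := leqP p N.
  have pN' : (p.-1 < N)%N by lia.
  have := h (Ordinal pN'); rewrite mem_index_enum mxE sqrf_eq0 /= prednK // => /(_ isT)/eqP.
  by [].
(* The pointwise inequalities, multiplied by [g] and summed, bound the Rayleigh quotient of [g] by
   [mu]. *)
move=> h; rewrite -(ler_pM2r yp) (le_trans h) // mxE big_distrr /=.
apply: ler_sum => i _; rewrite !mxE expr2 mulrA.
have -> : \sum_j y 0 j * H j i = \sum_j H i j * g j.+1.
  apply: eq_bigr => j _; rewrite -[in LHS]tr_hopping_matrix [in LHS]mxE mulrC.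
  by rewrite [H^T j i]mxE.
rewrite (hopping_matrixE c (fun i : 'I_N => g i.+1)) !gK.
have [->|gn0] := eqVneq (g i.+1) 0; first by rewrite !mulr0.
by rewrite ler_wpM2r // hmu.
Qed.

End Bounded.

End HoppingMatrix.

(** * Bounds from windows and free runs *)

Section Bounds.
Context {R : realType}.
Variables (c : nat -> R) (N : nat).
Hypotheses (N_gt0 : (0 < N)%N) (c_ge0 : forall j, 0 <= c j) (c_le1 : forall j, c j <= 1).
Local Notation H := (hopping_matrix c N).

(** * Confinement by blocked windows *)

Section Windows.
Variables (l : nat) (kappa : R).
Hypotheses (l_gt0 : (0 < l)%N) (kappa_gt0 : 0 < kappa).
Hypothesis windows : forall y, (0 < y)%N -> (y + l <= N)%N ->
  kappa <= \sum_(y.+1 <= e < (y + l).+1) (1 - c e).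

(** With [b = 1 - c] the matrix is minus the discrete Laplacian plus a nonnegative coupling by [b].
    Dropping the coupling gives almost convexity, and keeping it gives a small value in each
    window. *)
Lemma near_small_values (v : nat -> R) g M s p : 0 <= g -> v 0 = 0 ->
  (forall j, (N < j)%N -> v j = 0) -> (forall j, 0 <= v j <= M) ->
  (forall j, (j < N)%N ->
     2 * v j.+1 - c j.+1 * v j - c j.+2 * v j.+2 <= g) ->
  M + g * l%:R ^+ 2 < s * (kappa * l%:R) ->
  (forall j, - g <= v j.+2 - 2 * v j.+1 + v j) /\
  exists x0 x1, [/\ (x0 <= p <= x1)%N, (x1 - x0 <= l.+1)%N, v x0 <= s & v x1 <= s].
Proof.
move=> g0 v0 vN v0M hv hs.
have v_ge0 j : 0 <= v j by have /andP[] := v0M j.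
have v_leM j : v j <= M by have /andP[] := v0M j.
have bv i j : 0 <= (1 - c i) * v j by rewrite mulr_ge0 // subr_ge0.
have vconv j : - g <= v j.+2 - 2 * v j.+1 + v j.
  have [jN|Nj] := ltnP j N.
    by have := hv j jN; have := bv j.+1 j; have := bv j.+2 j.+2; lra.
  by rewrite (vN j.+1) ?(vN j.+2) //; [have := v_ge0 j; lra | lia].
have s0 : 0 <= s.
  have Kp : 0 < kappa * l%:R by rewrite mulr_gt0 // ltr0n.
  rewrite -(pmulr_lge0 _ Kp) ltW // (le_lt_trans _ hs) // addr_ge0 //.
    exact: le_trans (v_leM 0).
  by rewrite mulr_ge0 // sqr_ge0.
split => //; apply: (small_values_around p v0 s0 vN) => y y0 yl.
apply: (@small_value R v g g0 v0 v_ge0 vconv (fun j => 1 - c j) M s N l y kappa) => //.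
- by move=> j; rewrite subr_ge0.
- by move=> j jN; have := hv j jN; lra.
- exact: windows.
- by rewrite -mulrA.
Qed.

(** The norm stands on both sides because the small values near a maximum are only controlled
    relative to it. The inequality can be solved for the norm once [kappa * l] exceeds 1. *)
Lemma landscape_norm_le :
  mx_norm (landscape H) <=
  (mx_norm (landscape H) + l%:R ^+ 2) / (kappa * l%:R) + l.+1%:R ^+ 2 / 8.
Proof.
set M := mx_norm _; set K := kappa * _.
have Kp : 0 < K by rewrite mulr_gt0 // ltr0n.
(* The margin [e] provides the strict inequality that the search for small values requires. *)
apply/ler_addgt0Pr => e e0; set s0 := _ / K.
have hs : M + l%:R ^+ 2 < (s0 + e) * K.
  by rewrite mulrDl divfK ?gt_eqF // ltrDl mulr_gt0.
set s := s0 + e in hs.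
have [p pM] := landscape_norm_attained N_gt0 c_ge0 c_le1.
have [||||j jN||] := @near_small_values (landscape_seq c N) 1 M s p.
- exact: ler01.
- by [].
- exact: landscape_seq_out.
- by move=> j; rewrite landscape_seq_ge0 //= landscape_seq_le.
- by rewrite landscape_seqE.
- by rewrite mul1r.
move=> vconv [x0 [x1 [x0px1 xl h0 h1]]].
have /= := between_le (@ler01 R) (erefl : landscape_seq c N 0 = 0)
  (fun j => landscape_seq_ge0 N_gt0 c_ge0 c_le1 j) vconv x0px1 h0 h1.
rewrite pM -/M mul1r => hM.
have : (x1 - x0)%:R ^+ 2 <= l.+1%:R ^+ 2 :> R.
  by rewrite lerXn2r ?nnegrE // ler_nat.
rewrite /s in hM; lra.
Qed.

(** Since the ground state is at most 1, the eigenvalue itself serves as the constant source term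
    that yields small values around the maximum. Comparison with a cosine then uses the homogeneous
    inequality. *)
Lemma smallest_eigenvalue_ge (s th : R) :
  1 + smallest_eigenvalue H * l%:R ^+ 2 < s * (kappa * l%:R) ->
  0 <= th -> th * l.+1%:R <= pi -> s < cos (th * l.+1%:R / 2) ->
  2 - 2 * cos th <= smallest_eigenvalue H.
Proof.
move=> hs th0 thl hcos.
have [v [[lam0 [v0 vN] v01 [p vp] hv] _]] := ground_state N_gt0 c_ge0 c_le1.
set lam := smallest_eigenvalue H in lam0 hv hs *.
have v_ge0 j : 0 <= v j by have /andP[] := v01 j.
have v_le1 j : v j <= 1 by have /andP[] := v01 j.
have [|vconv [x0 [x1 [x0px1 xl h0 h1]]]] :=
    @near_small_values v lam 1 s p lam0 v0 vN v01 _ hs.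
  by move=> j jN; rewrite (le_trans (hv j jN)) // ler_piMr.
have s0 : 0 <= s := le_trans (v_ge0 _) h0.
apply: (@cos_gap_le_of_decay R v lam th s x0 p x1 l.+1) => // j.
have [jN|Nj] := ltnP j N.
  have bv i k : 0 <= (1 - c i) * v k by rewrite mulr_ge0 // subr_ge0.
  by have := hv j jN; have := bv j.+1 j; have := bv j.+2 j.+2; lra.
rewrite (vN j.+1) ?(vN j.+2) //; [by have := v_ge0 j; lra | lia].
Qed.

End Windows.

(** * Test functions on a free run *)

Section Run.
Variables (o L : nat) (eps : R).
Hypotheses (eps_ge0 : 0 <= eps) (run_le : (o + L < N)%N).
Hypothesis run : forall j, (o + 2 <= j)%N -> (j <= o + L + 1)%N -> 1 - c j <= eps.

(** The [L] edges of the run join the [L + 1] sites from [o + 1] to [o + L + 1], so a profile has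
    its boundary zeros at [o] and [o + L + 2], that is at the arguments [0] and [L.+2] of [h]. *)
Definition run_profile (h : nat -> R) (j : nat) : R :=
  if (o <= j <= o + L + 2)%N then h (j - o)%N else 0.

(** The two edges leaving the run are not controlled by [eps], but the profile vanishes at their
    outer ends. *)
Lemma run_profile_lap h : h 0 = 0 -> h L.+2 = 0 -> (forall i, (i <= L.+2)%N -> 0 <= h i) ->
  forall j, (o <= j <= o + L)%N ->
    2 * run_profile h j.+1 - c j.+1 * run_profile h j - c j.+2 * run_profile h j.+2
    <= 2 * h (j - o).+1 - (1 - eps) * (h (j - o)%N + h (j - o).+2).
Proof.
move=> h0 hm h_ge0 j /andP[oj jL].
have E i : (o <= i <= o + L + 2)%N -> run_profile h i = h (i - o)%N by rewrite /run_profile => ->.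
rewrite !E; [|lia..].
have -> : (j.+1 - o = (j - o).+1)%N by lia.
have -> : (j.+2 - o = (j - o).+2)%N by lia.
have e1 : (1 - eps) * h (j - o)%N <= c j.+1 * h (j - o)%N.
  have [jo|jo] := eqVneq j o; first by rewrite jo subnn h0 !mulr0.
  rewrite ler_wpM2r ?h_ge0 //; first by lia.
  have := @run j.+1; move=> /(_ _ _)/wrap[||]; [lia|lia|lra].
have e2 : (1 - eps) * h (j - o).+2 <= c j.+2 * h (j - o).+2.
  have [jo|jo] := eqVneq j (o + L)%N.
    have -> : ((j - o).+2 = L.+2)%N by lia.
    by rewrite hm !mulr0.
  rewrite ler_wpM2r ?h_ge0 //; first by lia.
  have := @run j.+2; move=> /(_ _ _)/wrap[||]; [lia|lia|lra].
lra.
Qed.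

Lemma run_profile_eq0 h j : h 0 = 0 -> h L.+2 = 0 -> ~~ (o < j <= o + L.+1)%N ->
  run_profile h j = 0.
Proof.
move=> h0 hm hj; rewrite /run_profile; case: ifP => // hj'.
have [->|->] : j = o \/ j = (o + L.+2)%N by lia.
  by rewrite subnn.
by rewrite addKn.
Qed.

Lemma smallest_eigenvalue_le :
  smallest_eigenvalue H <= (pi / L.+2%:R) ^+ 2 + 2 * eps.
Proof.
have [_ [_ ray]] := ground_state N_gt0 c_ge0 c_le1.
pose th : R := pi / L.+2%:R.
have m0 : 0 < L.+2%:R :> R by rewrite ltr0n.
have p0 := pi_gt0 R.
have thm : th * L.+2%:R = pi by rewrite /th divfK // gt_eqF.
have th0 : 0 < th by rewrite divr_gt0.
have thpi : th <= pi by rewrite ler_pdivrMr // ler_peMr ?(ltW p0) // ler1n.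
pose h (i : nat) := sin (i%:R * th).
have h0 : h 0%N = 0 by rewrite /h mul0r sin0.
have hm : h L.+2 = 0 by rewrite /h mulrC thm sinpi.
have h_ge0 i : (i <= L.+2)%N -> 0 <= h i.
  move=> im; rewrite sin_ge0_pi // mulr_ge0 //= ?(ltW th0) //.
  by rewrite -thm mulrC ler_pM2l // ler_nat.
(* The sine solves the free recurrence exactly, so this is the value of [mu] that it produces. *)
apply: (@le_trans _ _ (2 - 2 * (1 - eps) * cos th)); last first.
  have : 2 - 2 * cos th <= th ^+ 2 by rewrite cos_gap_le // (ltW th0).
  have : eps * cos th <= eps by rewrite ler_piMr // cos_le1.
  rewrite -/th; lra.
apply: (ray (run_profile h)).
- move=> j; rewrite /run_profile; case: ifP => // hj.
  by apply: h_ge0; lia.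
- exists o.+1; rewrite /run_profile ifT; last by lia.
  rewrite subSnn /h mul1r gt_eqF // sin_gt0_pi // th0 /=.
  by rewrite -thm ltr_pMr // ltr1n.
- by apply: run_profile_eq0 => //; lia.
- by move=> j jN; apply: run_profile_eq0 => //; lia.
- move=> j jN fj.
  have jo : (o <= j <= o + L)%N.
    by apply: contra_neqT fj => hj; apply: run_profile_eq0 => //; lia.
  rewrite (le_trans (run_profile_lap h0 hm h_ge0 jo)) //.
  have -> : run_profile h j.+1 = h (j - o).+1.
    by rewrite /run_profile ifT; [congr h; lia | lia].
  by rewrite /h sin_rec -/(h _); lra.
Qed.

(** The parabola [h] has second difference -1 and is at most [m ^+ 2 / 8]. The imperfect hopping
    adds at most [eps * m ^+ 2 / 4] to the right-hand side, so [1 + eta] times the landscape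
    dominates it. *)
Lemma landscape_norm_ge :
  L%:R ^+ 2 / 8 <= (1 + eps * L.+2%:R ^+ 2 / 4) * mx_norm (landscape H).
Proof.
pose m : R := L.+2%:R.
pose h (i : nat) : R := i%:R * (m - i%:R) / 2.
have h0 : h 0%N = 0 by rewrite /h mul0r mul0r.
have hm : h L.+2 = 0 by rewrite /h subrr mulr0 mul0r.
have h_ge0 i : (i <= L.+2)%N -> 0 <= h i.
  by move=> im; rewrite divr_ge0 // mulr_ge0 // subr_ge0 ler_nat.
have h_le i : h i <= m ^+ 2 / 8.
  rewrite /h; have := sqr_ge0 (m - 2 * i%:R); lra.
set eta := eps * _ / 4.
have etaE : eta = eps * m ^+ 2 / 4 by [].
have eta0 : 0 <= eta by rewrite /eta divr_ge0 // mulr_ge0 // sqr_ge0.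
pose F j := run_profile h j - (1 + eta) * landscape_seq c N j.
have FN j : (j <= N.+1)%N -> F j <= 0.
  apply: (minimum_principle N_gt0 c_ge0 c_le1).
  - by rewrite /F /landscape_seq /= mulr0 run_profile_eq0 ?subr0 //; lia.
  - by rewrite /F landscape_seq_out // mulr0 run_profile_eq0 ?subr0 //; lia.
  move=> k kN; have ueq := landscape_seqE N_gt0 c_ge0 c_le1 kN.
  suff : 2 * run_profile h k.+1 - c k.+1 * run_profile h k - c k.+2 * run_profile h k.+2
     <= 1 + eta.
    have : (1 + eta) * (2 * landscape_seq c N k.+1 - c k.+1 * landscape_seq c N k -
       c k.+2 * landscape_seq c N k.+2) = 1 + eta by rewrite ueq mulr1.
    rewrite /F; lra.
  have [ko|ko] := boolP (o <= k <= o + L)%N.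
    rewrite (le_trans (run_profile_lap h0 hm h_ge0 ko)) //.
    have : 2 * h (k - o).+1 - h (k - o)%N - h (k - o).+2 = 1.
      by rewrite /h -(natr1 (k - o).+1) -(natr1 (k - o)); field.
    have : eps * (h (k - o)%N + h (k - o).+2) <= eta.
      rewrite etaE -mulrA ler_wpM2l //; have := h_le (k - o)%N.
      by have := h_le (k - o).+2; lra.
    lra.
  have -> : run_profile h k.+1 = 0 by apply: run_profile_eq0 => //; lia.
  have p_ge0 i : 0 <= run_profile h i.
    by rewrite /run_profile; case: ifP => // hi; apply: h_ge0; lia.
  have := mulr_ge0 (c_ge0 k.+1) (p_ge0 k).
  by have := mulr_ge0 (c_ge0 k.+2) (p_ge0 k.+2); lra.
(* For odd [m] the middle value is [(m ^+ 2 - 1) / 8]; the target [(m - 2) ^+ 2 / 8] leaves room for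
   both parities. *)
pose i := (L.+2)./2.
have hi : L%:R ^+ 2 / 8 <= h i.
  have e : (L.+2 = odd L.+2 + (i + i))%N by rewrite addnn odd_double_half.
  have hb : (odd L.+2)%:R = 0 :> R \/ (odd L.+2)%:R = 1 :> R.
    by case: (odd _); [right | left].
  have mE : m = (odd L.+2)%:R + 2 * i%:R by rewrite /m {1}e !natrD; ring.
  have mL : m = L%:R + 2 by rewrite /m -addn2 natrD.
  rewrite /h; have L0 : 0 <= L%:R :> R by [].
  by case: hb mE => -> mE; nra.
rewrite (le_trans hi) // (@le_trans _ _ ((1 + eta) * landscape_seq c N (o + i))) //.
  have := FN (o + i)%N; rewrite subr_le0 => /(_ _)/wrap[|]; first by rewrite /i; lia.
  rewrite /run_profile ifT; last by rewrite /i; lia.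
  by rewrite addKn.
by rewrite ler_wpM2l ?addr_ge0 // landscape_seq_le.
Qed.

End Run.
End Bounds.

(** * The deterministic limit *)

Section Limit.
Context {R : realType}.
Implicit Types (c : nat -> R) (beta : R) (q n N : nat).

(** The threshold is [1 / q] times [(q n)^-2], the order of the eigenvalue of the run, so its effect
    disappears as [q] grows. *)
Definition has_free_run c q n N := exists o, (o + q * n < N)%N /\
  forall j, (o + 2 <= j)%N -> (j <= o + q * n + 1)%N -> 1 - c j <= (q ^ 3 * n ^ 2)%:R^-1.

(** The level [beta / n] times the window length is [beta * (q + 4)], which does not depend on [n]
    and is large with [q]. *)
Definition all_windows_blocked c beta q n N :=
  forall y, (0 < y)%N -> (y + (q + 4) * n <= N)%N ->
    beta / n%:R <= \sum_(y.+1 <= e < (y + (q + 4) * n).+1) (1 - c e).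

Section Scale.
Variables (c : nat -> R) (beta : R) (q n N : nat).
Hypotheses (c_ge0 : forall j, 0 <= c j) (c_le1 : forall j, c j <= 1).
Hypotheses (beta_gt0 : 0 < beta) (q_gt0 : (0 < q)%N) (n_gt0 : (0 < n)%N).
Hypotheses (run : has_free_run c q n N) (windows : all_windows_blocked c beta q n N).
(** In the unit [X] of squared length, all bounds depend on [q] and [beta] alone: [r] is the
    relative error, [K] the product [kappa * l] of the window bounds, and [A / X] bounds the
    eigenvalue. *)
Let r : R := q%:R^-1.
Let K : R := beta * (q + 4)%:R.
Let X : R := (q%:R * n%:R) ^+ 2.
Let A : R := pi ^+ 2 + 2 * r.

Let N_gt0 : (0 < N)%N. Proof. by case: run => o [? _]; lia. Qed.
Let q0 : 0 < q%:R :> R. Proof. by rewrite ltr0n. Qed.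
Let n0 : 0 < n%:R :> R. Proof. by rewrite ltr0n. Qed.
Let r0 : 0 < r. Proof. by rewrite invr_gt0. Qed.
Let rq : r * q%:R = 1. Proof. by rewrite mulVf // gt_eqF. Qed.
Let X0 : 0 < X. Proof. by rewrite exprn_gt0 // mulr_gt0. Qed.
Let l_gt0 : (0 < (q + 4) * n)%N. Proof. by lia. Qed.
Let kappa_gt0 : 0 < beta / n%:R. Proof. exact: divr_gt0. Qed.
Let K0 : 0 < K. Proof. by rewrite mulr_gt0 // ltr0n; lia. Qed.
Let kappaE : beta / n%:R * ((q + 4) * n)%:R = K.
Proof. by rewrite natrM /K; field; rewrite gt_eqF. Qed.
Let l_sqr : ((q + 4) * n)%:R ^+ 2 = X * (1 + 4 * r) ^+ 2.
Proof. by rewrite /X /r natrM natrD; field; rewrite gt_eqF. Qed.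
Let l_le : ((q + 4) * n).+1%:R <= q%:R * n%:R * (1 + 5 * r).
Proof.
have -> : q%:R * n%:R * (1 + 5 * r) = ((q + 5) * n)%:R.
  by rewrite /r natrM natrD; field; rewrite gt_eqF.
by rewrite ler_nat; lia.
Qed.
Let epsE : (q ^ 3 * n ^ 2)%:R^-1 = r / X.
Proof. by rewrite /X /r natrM !natrX; field; rewrite !gt_eqF. Qed.

Lemma smallest_eigenvalue_le_scale : smallest_eigenvalue (hopping_matrix c N) <= A / X.
Proof.
case: run => o [oN hrun].
have := smallest_eigenvalue_le N_gt0 c_ge0 c_le1 _ oN hrun.
rewrite epsE => /(_ _)/wrap[|h]; first by rewrite divr_ge0 ?ltW.
apply: le_trans h _; rewrite /A [(_ + 2 * r) / X]mulrDl mulrA lerD2r expr_div_n.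
rewrite ler_pM2l ?exprn_gt0 ?pi_gt0 // lef_pV2 ?posrE ?exprn_gt0 ?mulr_gt0 ?ltr0n //.
by rewrite /X -natrM lerXn2r ?nnegrE // ler_nat; lia.
Qed.

Lemma landscape_product_le : 1 < K ->
  landscape_product c N <=
  A * ((1 + 4 * r) ^+ 2 / K + (1 + 5 * r) ^+ 2 / 8) / (1 - K^-1).
Proof.
move=> K1; rewrite /landscape_product.
have [? [[lam0 _ _ _ _] _]] := ground_state N_gt0 c_ge0 c_le1.
have := smallest_eigenvalue_le_scale.
have := landscape_norm_le N_gt0 c_ge0 c_le1 l_gt0 kappa_gt0 windows.
rewrite kappaE l_sqr.
set lam := smallest_eigenvalue _ in lam0 *.
set M := mx_norm _ => hM hlam.
have K1' : 0 < 1 - K^-1 by rewrite subr_gt0 invf_lt1.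
rewrite ler_pdivlMr // -mulrA.
(* The term [M / K] of the norm bound is absorbed on the left. *)
have h1 : M * (1 - K^-1) <= X * ((1 + 4 * r) ^+ 2 / K + (1 + 5 * r) ^+ 2 / 8).
  have : ((q + 4) * n).+1%:R ^+ 2 <= X * (1 + 5 * r) ^+ 2.
    by rewrite /X -exprMn lerXn2r ?nnegrE // (le_trans _ l_le).
  rewrite mulrDl in hM; lra.
have -> : A * ((1 + 4 * r) ^+ 2 / K + (1 + 5 * r) ^+ 2 / 8)
   = A / X * (X * ((1 + 4 * r) ^+ 2 / K + (1 + 5 * r) ^+ 2 / 8)).
  by rewrite [RHS]mulrA divfK // gt_eqF.
by rewrite ler_pM // mulr_ge0 ?mx_norm_ge0 // ltW.
Qed.

(** The frequency is chosen slightly below [pi] over the interval length, by the factor [1 - d], so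
    that the cosine stays positive at both ends and can dominate the small boundary values. *)
Lemma landscape_product_ge d : 0 <= d -> d <= 1 ->
  (2 + A * (1 + 4 * r) ^+ 2) / K < cos ((1 - d) * pi / 2) ->
  (1 - d) ^+ 2 * pi ^+ 2 / 8 * ((1 - 4 * r ^+ 2) / ((1 + 5 * r) ^+ 2 * (1 + 3 * r)))
  <= landscape_product c N.
Proof.
move=> d0 d1 hs; rewrite /landscape_product.
have p0 := pi_gt0 R; have p4 := pihalf_lt2 R.
case: run => o [oN hrun].
have lamA := smallest_eigenvalue_le_scale.
have := landscape_norm_ge N_gt0 c_ge0 c_le1 _ oN hrun.
rewrite epsE => /(_ _)/wrap[|]; first by rewrite divr_ge0 ?ltW.
set m := ((q + 4) * n).+1.
have m0 : 0 < m%:R :> R by rewrite ltr0n.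
pose th : R := (1 - d) * pi / m%:R.
have thm : th * m%:R = (1 - d) * pi by rewrite divfK // gt_eqF.
have th0 : 0 <= th by rewrite divr_ge0 ?mulr_ge0 ?subr_ge0 // ltW.
have thle : th <= 4 * r.
  rewrite /th ler_pdivrMr //.
  have : 1 <= r * m%:R by rewrite -[leLHS]rq ler_pM2l // ler_nat leqW //
      (leq_trans (leq_addr 4 q) (leq_pmulr _ n_gt0)).
  have : (1 - d) * pi <= pi by rewrite ler_piMl ?(ltW p0) // gerBl.
  lra.
have := @smallest_eigenvalue_ge R c N N_gt0 c_ge0 c_le1 _ _ l_gt0 kappa_gt0 windows _ th.
rewrite kappaE l_sqr -/m thm.
move=> /(_ _ _ th0 _ hs)/wrap[||].
(* The constant 2 in the hypothesis, where 1 would match, makes this inequality strict. *)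
- rewrite divfK ?gt_eqF //.
  have : smallest_eigenvalue (hopping_matrix c N) * (X * (1 + 4 * r) ^+ 2)
     <= A / X * (X * (1 + 4 * r) ^+ 2) by rewrite ler_wpM2r // mulr_ge0 ?sqr_ge0 // ltW.
  by rewrite [leRHS]mulrA divfK ?gt_eqF //; lra.
- by rewrite ler_piMl ?(ltW p0) // gerBl.
set lam := smallest_eigenvalue _ in lamA *.
set M := mx_norm _ => hlam hM.
have M0 : 0 <= M := mx_norm_ge0 _.
(* In the first case the claimed lower bound is nonpositive. *)
have [r12|r12] := leP 1 (4 * r ^+ 2).
  have [? [[lam0 _ _ _ _] _]] := ground_state N_gt0 c_ge0 c_le1.
  apply: le_trans (mulr_ge0 lam0 M0).
  apply: mulr_ge0_le0; first by rewrite divr_ge0 // mulr_ge0 // sqr_ge0.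
  by rewrite pmulr_lle0 ?subr_le0 // invr_gt0 mulr_gt0 ?exprn_gt0 // ltr_pwDl // mulr_ge0 // ltW.
(* The correction [th ^+ 2 / 4] of the cosine gap is at most [4 * r ^+ 2] by [thle]. *)
have hth : th ^+ 2 * (1 - 4 * r ^+ 2) <= lam.
  apply: le_trans hlam; apply: le_trans (cos_gap_ge _); last first.
    by rewrite th0 /=; nra.
  by rewrite ler_wpM2l ?sqr_ge0 //; nra.
(* From [q n + 2 <= 3 q n], the error [eps m^2 / 4] is at most [9 r / 4]. *)
have hM' : X / 8 <= (1 + 3 * r) * M.
  apply: le_trans (_ : _ <= (q * n)%:R ^+ 2 / 8) _; first by rewrite natrM.
  apply: le_trans hM _; rewrite ler_wpM2r // lerD2l.
  have : (q * n).+2%:R ^+ 2 <= 9 * X.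
    have -> : 9 * X = (3 * (q * n))%:R ^+ 2 by rewrite /X !natrM; ring.
    have qn0 : (0 < q * n)%N by rewrite muln_gt0 q_gt0.
    rewrite lerXn2r ?nnegrE // ler_nat.
    by move: (q * n)%N qn0 => k; clear; lia.
  move=> h; rewrite ler_pdivrMr // mulrAC ler_pdivrMr //.
  have : r * (q * n).+2%:R ^+ 2 <= r * (9 * X) by rewrite ler_pM2l.
  have : 0 <= r * X by rewrite mulr_ge0 // ltW.
  lra.
have rr0 : 0 < (1 + 5 * r) ^+ 2 * (1 + 3 * r).
  by rewrite mulr_gt0 ?exprn_gt0 // ltr_pwDl // mulr_ge0 // ltW.
rewrite mulrA ler_pdivrMr //.
have hX : (1 - d) ^+ 2 * pi ^+ 2 <= th ^+ 2 * (X * (1 + 5 * r) ^+ 2).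
  rewrite -exprMn -thm exprMn ler_wpM2l ?sqr_ge0 //.
  by rewrite /X -exprMn lerXn2r ?nnegrE // (le_trans _ l_le).
have r2 : 0 <= 1 - 4 * r ^+ 2 by rewrite subr_ge0 ltW.
have e1 : (1 - d) ^+ 2 * pi ^+ 2 * (1 - 4 * r ^+ 2) <=
   th ^+ 2 * (X * (1 + 5 * r) ^+ 2) * (1 - 4 * r ^+ 2) by rewrite ler_wpM2r.
have e2 : th ^+ 2 * (1 - 4 * r ^+ 2) * (X / 8) <= lam * ((1 + 3 * r) * M).
  by apply: ler_pM => //; [rewrite mulr_ge0 // sqr_ge0 | rewrite divr_ge0 // ltW].
have e3 : th ^+ 2 * (1 - 4 * r ^+ 2) * (X / 8) * (1 + 5 * r) ^+ 2 <=
    lam * ((1 + 3 * r) * M) * (1 + 5 * r) ^+ 2 by rewrite ler_wpM2r // sqr_ge0.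
lra.
Qed.

End Scale.

Theorem landscape_product_near_limit beta tau : 0 < beta -> 0 < tau ->
  exists2 q, (0 < q)%N & forall n N c, (0 < n)%N ->
    (forall j, 0 <= c j) -> (forall j, c j <= 1) ->
    has_free_run c q n N -> all_windows_blocked c beta q n N ->
    `|pi ^+ 2 / 8 - landscape_product c N| <= tau.
Proof.
move=> beta0 tau0.
have p0 := pi_gt0 R; have p4 := pihalf_lt2 R.
(* The factor [(1 - d) ^+ 2] loses at most [2 d pi^2 / 8], which is at most [tau / 2] because
   [pi^2 <= 16]; the other half of [tau] pays for the limit in [q]. *)
pose d : R := Num.min (1 / 2) (tau / 8).
have d0 : 0 < d by rewrite lt_min; apply/andP; split; lra.
have d1 : d <= 1 / 2 by rewrite ge_min lexx.
have dtau : d <= tau / 8 by rewrite ge_min lexx orbT.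
pose r (p : nat) : R := p.+1%:R^-1.
have cr : r @ \oo --> (0 : R) := cvg_harmonic.
(* With [q = p + 1], this is the inverse of [K = beta * (q + 4)]. Below, [V] and [W] are the upper
   and lower bounds at a scale, and [S] is the level of the small values. *)
pose k p : R := r p / (beta * (1 + 4 * r p)).
have sq (f : nat -> R) (x : R) : f @ \oo --> x -> (fun p => f p ^+ 2) @ \oo --> x ^+ 2.
  move=> fx; rewrite expr2; under eq_fun do rewrite expr2.
  exact: cvgM.
have cc (x : R) : (fun=> x) @ \oo --> x by exact: cvg_cst.
have lin (x : R) : (fun p => 1 + x * r p) @ \oo --> (1 : R).
  rewrite -[X in _ --> X]addr0 -[X in 1 + X](mulr0 x).
  by apply: cvgD; [exact: cc | apply: cvgM; [exact: cc | exact: cr]].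
have lin2 (x : R) : (fun p => (1 + x * r p) ^+ 2) @ \oo --> (1 : R).
  by rewrite -[X in _ --> X](expr1n R 2); apply: sq.
have ck : k @ \oo --> (0 : R).
  rewrite -[X in _ --> X](mul0r (beta * 1)^-1); apply: cvgM => //.
  apply: cvgV; first by rewrite mulr1 gt_eqF.
  by apply: cvgM; [exact: cc | exact: lin].
have cA : (fun p => pi ^+ 2 + 2 * r p) @ \oo --> (pi ^+ 2 : R).
  rewrite -[X in _ --> X]addr0 -[X in _ + X](mulr0 2).
  by apply: cvgD; [exact: cc | apply: cvgM; [exact: cc | exact: cr]].
pose V p : R := (pi ^+ 2 + 2 * r p) * ((1 + 4 * r p) ^+ 2 * k p + (1 + 5 * r p) ^+ 2 / 8)
   / (1 - k p).
have cV : V @ \oo --> (pi ^+ 2 / 8 : R).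
  have -> : pi ^+ 2 / 8 = pi ^+ 2 * (1 * 0 + 1 / 8) / (1 - 0) :> R by rewrite subr0; field.
  apply: cvgM; last first.
    apply: cvgV; first by rewrite subr0 oner_eq0.
    by apply: cvgB; [exact: cc | exact: ck].
  apply: cvgM => //; apply: cvgD; first by apply: cvgM; [exact: lin2|exact: ck].
  by apply: cvgM; [exact: lin2|exact: cc].
pose S p : R := (2 + (pi ^+ 2 + 2 * r p) * (1 + 4 * r p) ^+ 2) * k p.
have cS : S @ \oo --> (0 : R).
  rewrite -[X in _ --> X](mulr0 (2 + pi ^+ 2 * 1)).
  apply: cvgM => //; apply: cvgD; first exact: cc.
  by apply: cvgM => //; exact: lin2.
pose W p : R := (1 - d) ^+ 2 * pi ^+ 2 / 8 *
   ((1 - 4 * r p ^+ 2) / ((1 + 5 * r p) ^+ 2 * (1 + 3 * r p))).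
have cW : W @ \oo --> ((1 - d) ^+ 2 * pi ^+ 2 / 8 : R).
  rewrite -[X in _ --> X]mulr1 -[X in _ * X](_ : (1 - 4 * 0 ^+ 2) / (1 * 1) = 1); last by field.
  apply: cvgM; first exact: cc; apply: cvgM.
    by apply: cvgB; [exact: cc | apply: cvgM; [exact: cc | exact: sq]].
  apply: cvgV; first by rewrite mulr1 oner_eq0.
  by apply: cvgM; [exact: lin2 | exact: lin].
have C0 : 0 < cos ((1 - d) * pi / 2) :> R.
  by apply: cos_gt0_pihalf; apply/andP; split; nra.
have nV : \forall p \near \oo, V p < pi ^+ 2 / 8 + tau.
  by apply: (cvgr_lt _ cV); rewrite ltrDl.
have nS : \forall p \near \oo, S p < cos ((1 - d) * pi / 2) by exact: (cvgr_lt _ cS).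
have nW : \forall p \near \oo, (1 - d) ^+ 2 * pi ^+ 2 / 8 - tau / 2 < W p.
  by apply: (cvgr_gt _ cW); lra.
have nk : \forall p \near \oo, k p < 1 by apply: (cvgr_lt _ ck).
have [p [[hV hS] [hW hk]]] : exists p, (V p < pi ^+ 2 / 8 + tau /\ S p < cos ((1 - d) * pi / 2)) /\
   ((1 - d) ^+ 2 * pi ^+ 2 / 8 - tau / 2 < W p /\ k p < 1).
  by have [p hp] := filter_ex (filterI (filterI nV nS) (filterI nW nk)); exists p.
exists p.+1 => // n N c n0 c0 c1 run win.
have rE : p.+1%:R^-1 = r p by [].
have kE : (beta * (p.+1 + 4)%:R)^-1 = k p.
  have p1 : 0 < p%:R + 1 :> R by rewrite ltr_wpDl.
  by rewrite /k /r natrD -natr1; field; rewrite !gt_eqF //; lra.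
have K1 : 1 < beta * (p.+1 + 4)%:R.
  by rewrite -invf_lt1 ?kE // mulr_gt0 // ltr0n addnS.
have h1 := landscape_product_le c0 c1 beta0 (ltn0Sn p) n0 run win K1.
have := @landscape_product_ge c beta p.+1 n N c0 c1 beta0 (ltn0Sn p) n0 run win d (ltW d0).
rewrite kE rE => /(_ _ hS)/wrap[|h2]; first by lra.
rewrite kE rE -/(V p) in h1; rewrite -/(W p) in h2.
rewrite ler_norml; apply/andP; split; first by lra.
have : (1 - 2 * d) * (pi ^+ 2 / 8) <= (1 - d) ^+ 2 * pi ^+ 2 / 8.
  by rewrite -[leRHS]mulrA ler_wpM2r ?divr_ge0 ?sqr_ge0 //; have := sqr_ge0 d; lra.
have : d * pi ^+ 2 <= tau / 8 * 16.
  by rewrite ler_pM ?sqr_ge0 ?(ltW d0) //; nra.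
lra.
Qed.

End Limit.

(** * Independent trials *)

Section BorelCantelli.
Context d (T : measurableType d) (R : realType) (P : probability T R).

Lemma measure_bigsetU_le (I : Type) (r : seq I) (Q : pred I) (F : I -> set T) (x : R) :
  0 <= x -> (forall i, Q i -> measurable (F i)) -> (forall i, Q i -> (P (F i) <= x%:E)%E) ->
  (P (\big[setU/set0]_(i <- r | Q i) F i) <= (\sum_(i <- r | Q i) x)%:E)%E.
Proof.
move=> x0 mF Fx; elim: r => [|i r IH]; first by rewrite !big_nil measure0.
rewrite !big_cons; case: ifP => // Qi.
rewrite (le_trans (measureU2 _ (mF _ Qi) _)) ?EFinD ?leeD ?Fx //.
exact: bigsetU_measurable.
Qed.

Lemma ae_eventually_not (A : nat -> set T) (C rho : R) (n0 : nat) :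
  (forall n, measurable (A n)) -> 0 <= C -> 0 < rho < 1 ->
  (forall n, (n0 <= n)%N -> (P (A n) <= (C * rho ^+ n)%:E)%E) ->
  {ae P, forall w, exists n1, forall n, (n1 <= n)%N -> ~ A n w}.
Proof.
move=> mA C0 /andP[rho0 rho1] hA.
pose B n := A (n + n0)%N.
have mB n : measurable (B n) by exact: mA.
have B0 : P (lim_sup_set B) = 0%E.
  apply: lim_sup_set_cvg0 => //.
  apply: (@le_lt_trans _ _ (C / (1 - rho))%:E); last exact: ltry.
  apply: lime_le; first by apply: is_cvg_nneseries => n _ _.
  apply: nearW => n; rewrite big_mkord.
  apply: (@le_trans _ _ (series (geometric C rho) n)%:E).
    rewrite /series /= -sumEFin big_mkord; apply: lee_sum => i _.
    apply: le_trans (hA _ (leq_addl _ _)) _; rewrite lee_fin ler_wpM2l //.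
    by rewrite ler_wiXn2l ?leq_addr // ltW.
  by rewrite lee_fin geometric_le_lim // gtr0_norm.
exists (lim_sup_set B); split => //.
  by apply: bigcap_measurable => [|k _]; [exists 0%N | apply: bigcup_measurable].
move=> w /= hw n _; apply: contrapT => hn; apply: hw; exists (n + n0)%N => k nk Ak.
apply: hn; exists (k - n0)%N => /=; first by lia.
by rewrite /B subnK //; lia.
Qed.

End BorelCantelli.

Section IndependentTrials.
Context d (T : measurableType d) (R : realType) (P : probability T R)
  (X : nat -> {RV P >-> R}).
Hypothesis X_iid : iid_from2 X.

Definition all_in (G : set R) (s : seq nat) : set T :=
  \bigcap_(j in [set` s]) (X j @^-1` G).

Definition no_full_block (G : set R) (L M : nat) : set T :=
  \bigcap_(i in `I_M) ~` all_in G (iota (2 + i * L) L).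

(** Written as a union over sets of positions, so that the union bound leaves only independent
    trials at fixed positions. *)
Definition crowded (G : set R) (l m N : nat) : set T :=
  \big[setU/set0]_(y < N) \big[setU/set0]_(S : {set 'I_l} | (m <= #|S|)%N)
    all_in G [seq (y + 2 + val j)%N | j <- enum S].

Lemma all_in_cat G s t : all_in G (s ++ t) = all_in G s `&` all_in G t.
Proof.
apply/seteqP; split => [w hw|w [hs ht] j] /=.
  by split => j /= js; apply: hw; rewrite /= mem_cat js ?orbT.
by rewrite mem_cat => /orP[/hs|/ht].
Qed.

Section Law.
Variables (G : set R) (g : R).
Hypotheses (mG : measurable G) (gE : P (X 2 @^-1` G) = g%:E).

Lemma measurable_all_in s : measurable (all_in G s).
Proof.
apply: fin_bigcap_measurable; first exact: finite_seq.
by move=> j _; exact: measurable_funPTI.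
Qed.

Lemma measurable_no_full_block L M : measurable (no_full_block G L M).
Proof.
apply: fin_bigcap_measurable => // i _; apply: measurableC.
exact: measurable_all_in.
Qed.

Lemma measurable_crowded l m N : measurable (crowded G l m N).
Proof. by do 2 apply: bigsetU_measurable => ? _; exact: measurable_all_in. Qed.

Lemma prob_all_in s : uniq s -> (forall j, j \in s -> (2 <= j)%N) ->
  P (all_in G s) = (g ^+ size s)%:E.
Proof.
move=> us s2; rewrite /all_in (X_iid.1 s (fun=> G)) //.
elim: s {us} s2 => [|j s IH] s2; first by rewrite big_nil.
rewrite big_cons IH => [|i si]; last by apply: s2; rewrite inE si orbT.
rewrite exprS EFinM; congr (_ * _)%E.
rewrite -gE; apply: (X_iid.2 j 2) => //.
by apply: s2; rewrite inE eqxx.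
Qed.

Lemma law_ge0_le1 : 0 <= g <= 1.
Proof.
rewrite -!lee_fin -gE measure_ge0 /= probability_le1 //.
exact: measurable_funPTI.
Qed.

(** Independence is stated for intersections only, so the complements are removed one block at a
    time: the last block is either avoided or joined to [s]. Carrying a list [s] of later indices
    makes the induction close. *)
Lemma prob_no_full_block_and L M s : uniq s ->
  (forall j, j \in s -> (2 + M * L <= j)%N) ->
  P (no_full_block G L M `&` all_in G s) = ((1 - g ^+ L) ^+ M * g ^+ size s)%:E.
Proof.
elim: M s => [|M IH] s us hs.
  rewrite /no_full_block bigcap_mkord big_ord0 setTI mul1r prob_all_in //.
have -> : no_full_block G L M.+1 =
    no_full_block G L M `\` all_in G (iota (2 + M * L) L).
  by rewrite /no_full_block IIS bigcap_setU bigcap_set1 setDE.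
rewrite setDE setIAC -setDE.
have mA := measurable_no_full_block L M.
set B := all_in G (iota _ _).
have : P (no_full_block G L M `&` all_in G s) =
    (P ((no_full_block G L M `&` all_in G s) `\` B) +
     P (no_full_block G L M `&` all_in G (s ++ iota (2 + M * L) L)))%E.
  rewrite all_in_cat setIA; apply: measureDI; last exact: measurable_all_in.
  by apply: measurableI => //; exact: measurable_all_in.
rewrite !IH; last 4 first.
- rewrite cat_uniq us iota_uniq andbT /=; apply/hasPn => j; rewrite mem_iota => hj.
  by apply/negP => /hs; lia.
- by move=> j; rewrite mem_cat mem_iota => /orP[/hs|]; lia.
- exact: us.
- by move=> j /hs; lia.
set Z := P (_ `\` B).
have Zfin : Z \is a fin_num.
  apply: fin_num_measure; apply: measurableD; last exact: measurable_all_in.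
  by apply: measurableI => //; exact: measurable_all_in.
rewrite -(fineK Zfin) -EFinD size_cat size_iota exprD => -[e].
by congr (_%:E); rewrite [in RHS]exprS; lra.
Qed.

Lemma prob_no_full_block L M : P (no_full_block G L M) = ((1 - g ^+ L) ^+ M)%:E.
Proof.
have := @prob_no_full_block_and L M [::] isT; rewrite mulr1 => <- //.
by congr (P _); rewrite /all_in bigcap_seq big_nil setIT.
Qed.

Lemma prob_crowded l m N :
  (P (crowded G l m N) <=
   (N%:R * (#|[pred S : {set 'I_l} | (m <= #|S|)%N]|%:R * g ^+ m))%:E)%E.
Proof.
have /andP[g0 g1] := law_ge0_le1.
set k := #|_|.
rewrite (le_trans (@measure_bigsetU_le _ _ _ P _ _ _ _ (k%:R * g ^+ m) _ _ _)) //.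
- by rewrite mulr_ge0 // exprn_ge0.
- by move=> y _; apply: bigsetU_measurable => S _; exact: measurable_all_in.
- move=> y _; rewrite (le_trans (@measure_bigsetU_le _ _ _ P _ _ _ _ (g ^+ m) _ _ _)) //.
  + by rewrite exprn_ge0.
  + by move=> S _; exact: measurable_all_in.
  + move=> S mS; rewrite prob_all_in.
    * by rewrite size_map -cardE lee_fin ler_wiXn2l.
    * rewrite map_inj_uniq ?enum_uniq // => i j /addnI; exact: val_inj.
    * by move=> j /mapP[i _ ->]; lia.
  + by rewrite sumr_const lee_fin mulr_natl.
- by rewrite sumr_const card_ord lee_fin [leRHS]mulr_natl.
Qed.

End Law.

Lemma not_crowded G l m N w y : (y < N)%N -> ~ crowded G l m N w ->
  (#|[pred j : 'I_l | X (y + 2 + j)%N w \in G]| < m)%N.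
Proof.
move=> yN hw; rewrite ltnNge; apply/negP => hm; apply: hw.
rewrite /crowded -bigcup_seq; exists (Ordinal yN); first by rewrite /= mem_index_enum.
rewrite /= -bigcup_seq_cond; exists [set j : 'I_l | X (y + 2 + j)%N w \in G]%SET.
  by rewrite /= mem_index_enum cardsE.
by move=> i /= /mapP[j]; rewrite mem_enum finset.inE => /set_mem hj ->.
Qed.

End IndependentTrials.

(** Bernoulli's inequality gives [(1 - x)^M (M x) <= (1 - x)^M (1 + x)^M = (1 - x^2)^M <= 1]. *)
Lemma expr1B_le_inv (R : realFieldType) (x : R) M : 0 < x <= 1 -> (0 < M)%N ->
  (1 - x) ^+ M <= (M%:R * x)^-1.
Proof.
move=> /andP[x0 x1] M0.
have h : 1 + M%:R * x <= (1 + x) ^+ M.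
  elim: M {M0} => [|M IH]; first by rewrite mul0r addr0.
  rewrite exprS; apply: (@le_trans _ _ ((1 + x) * (1 + M%:R * x))).
    have : 0 <= M%:R * x ^+ 2 by rewrite mulr_ge0 ?sqr_ge0.
    by rewrite -natr1; lra.
  by rewrite ler_wpM2l // addr_ge0 // ltW.
have Mx : 0 < M%:R * x by rewrite mulr_gt0 // ltr0n.
rewrite -[leRHS]mul1r ler_pdivlMr //.
apply: (@le_trans _ _ ((1 - x) ^+ M * (1 + x) ^+ M)).
  by rewrite ler_wpM2l ?exprn_ge0 ?subr_ge0 //; lra.
rewrite -exprMn exprn_ile1 //; last by have := sqr_ge0 x; lra.
by rewrite mulr_ge0 ?subr_ge0 // addr_ge0 // ltW.
Qed.

(** * Almost sure existence of a good scale *)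

Section Scales.
Context d (T : measurableType d) (R : realType) (P : probability T R)
  (X : nat -> {RV P >-> R}).
Hypothesis X_iid : iid_from2 X.
Variables (q : nat) (G G' : nat -> set R) (g g' : nat -> R) (m : nat -> nat).
Hypotheses (q_gt0 : (0 < q)%N) (mG : forall n, measurable (G n))
  (mG' : forall n, measurable (G' n)).
Hypotheses (gE : forall n, P (X 2 @^-1` G n) = (g n)%:E)
  (g'E : forall n, P (X 2 @^-1` G' n) = (g' n)%:E).

(* About [g ^- n] of these blocks of length [q n] are expected to be free. *)
Definition num_blocks n := (Num.truncn ((g n)^-1 ^+ ((q + 1) * n))).+1.

Definition scale_size n := (q * n * num_blocks n + 2)%N.

(** [G n] is meant for the free values and [G' n] for those too close to 1 to block, of which a
    window may hold fewer than [m n]. Crowding is tested up to the next size because scale [n]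
    serves every [N] below [scale_size n.+1]. *)
Definition bad_scale n := no_full_block X (G n) (q * n) (num_blocks n) `|`
  crowded X (G' n) ((q + 4) * n) (m n) (scale_size n.+1).

Lemma measurable_bad_scale n : measurable (bad_scale n).
Proof.
by apply: measurableU; [exact: measurable_no_full_block | exact: measurable_crowded].
Qed.

(** There are at least [g^(-(q+1) n)] blocks, each free with probability [g^(q n)], so the absence
    of a free one has probability at most [g^n]. The factor 4 covers both the rounding in
    [num_blocks] and the [+ 2] in [scale_size]. *)
Lemma prob_bad_scale n : 0 < g n -> 0 < g n.+1 ->
  (P (bad_scale n) <= (g n ^+ n + 4 * (q * n.+1)%:R * (g n.+1)^-1 ^+ ((q + 1) * n.+1)
    * (#|[pred S : {set 'I_((q + 4) * n)} | (m n <= #|S|)%N]|%:R * g' n ^+ m n))%:E)%E.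
Proof.
move=> gn0 gS0.
have le1 k : g k <= 1 by have /andP[] := law_ge0_le1 (mG k) (gE k).
have /andP[g'0 g'1] := law_ge0_le1 (mG' n) (g'E n).
have inv_ge1 k : 0 < g k -> 1 <= (g k)^-1 ^+ ((q + 1) * k).
  by move=> gk; rewrite exprn_ege1 // invf_ge1.
apply: (@le_trans _ _ (P (no_full_block X (G n) (q * n) (num_blocks n)) +
    P (crowded X (G' n) ((q + 4) * n) (m n) (scale_size n.+1)))%E).
  by apply: measureU2; [exact: measurable_no_full_block | exact: measurable_crowded].
rewrite EFinD leeD //.
  rewrite (prob_no_full_block X_iid _ (gE n)) // lee_fin.
  have x1 : 0 < g n ^+ (q * n) <= 1 by rewrite exprn_gt0 //= exprn_ile1 // ltW.
  rewrite (le_trans (expr1B_le_inv x1 (ltn0Sn _))) //.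
  have : (g n)^-1 ^+ ((q + 1) * n) <= (num_blocks n)%:R.
    rewrite ltW // /num_blocks; apply: truncnS_gt.
  rewrite -/(num_blocks n) => hb.
  have hx : (g n ^+ n)^-1 = (g n)^-1 ^+ ((q + 1) * n) * g n ^+ (q * n).
    by rewrite mulnDl mul1n exprD exprVn mulrAC mulVf ?mul1r ?exprVn // expf_neq0 // gt_eqF.
  rewrite -[leRHS]invrK lef_pV2 ?posrE.
  - by rewrite hx ler_wpM2r // exprn_ge0 // ltW.
  - by rewrite mulr_gt0 ?exprn_gt0 // ltr0n.
  - by rewrite invr_gt0 exprn_gt0.
rewrite (le_trans (prob_crowded X_iid (mG' n) (g'E n) _ _ _)) // lee_fin.
rewrite ler_wpM2r ?mulr_ge0 ?exprn_ge0 //.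
rewrite /scale_size natrD natrM.
have hb : (num_blocks n.+1)%:R <= 2 * (g n.+1)^-1 ^+ ((q + 1) * n.+1).
  rewrite /num_blocks -natr1.
  have : (Num.truncn ((g n.+1)^-1 ^+ ((q + 1) * n.+1)))%:R <= (g n.+1)^-1 ^+ ((q + 1) * n.+1).
    by rewrite truncn_le exprn_ge0 // invr_ge0 ltW.
  by have := inv_ge1 _ gS0; lra.
have qn1 : 1 <= (q * n.+1)%:R :> R by rewrite ler1n muln_gt0 q_gt0.
have := inv_ge1 _ gS0.
set x := _ ^+ _ in hb *; set y := (q * n.+1)%:R in qn1 *; set z := (num_blocks _)%:R in hb *.
move=> x1.
have : y * z <= y * (2 * x) by rewrite ler_wpM2l //; lra.
have : 1 <= y * x by rewrite mulr_ege1.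
lra.
Qed.

Lemma ae_good_scales (C rho : R) (n0 : nat) : 0 < rho < 1 -> 0 <= C ->
  (forall n, (n0 <= n)%N -> 0 < g n <= rho) ->
  (forall n, (n0 <= n)%N ->
    (q * n.+1)%:R * (g n.+1)^-1 ^+ ((q + 1) * n.+1)
    * (#|[pred S : {set 'I_((q + 4) * n)} | (m n <= #|S|)%N]|%:R * g' n ^+ m n)
    <= C * rho ^+ n) ->
  {ae P, forall w, forall k, exists N0, forall N, (N0 <= N)%N -> exists2 n, (k <= n)%N &
    (exists o, (o + q * n < N)%N /\
       forall j, (o + 2 <= j)%N -> (j <= o + q * n + 1)%N -> G n (X j w)) /\
    (forall y, (y < N)%N ->
       (#|[pred j : 'I_((q + 4) * n) | X (y + 2 + j)%N w \in G' n]| < m n)%N)}.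
Proof.
move=> rho01 C0 hg hB.
have := @ae_eventually_not _ _ _ P bad_scale (1 + 4 * C) rho n0 measurable_bad_scale _ rho01 _.
move=> /(_ _ _)/wrap[||]; first by rewrite addr_ge0 // mulr_ge0.
  move=> n n0n; have /andP[gn0 gnr] := hg n n0n.
  have /andP[gS0 _] := hg n.+1 (leqW n0n).
  rewrite (le_trans (prob_bad_scale gn0 gS0)) // lee_fin [leRHS]mulrDl mul1r lerD //.
    by rewrite lerXn2r ?nnegrE ?(ltW gn0) //; case/andP: rho01 => /ltW.
  by have := hB n n0n; rewrite -!mulrA; lra.
apply: filterS => w [n1 hn1] k.
pose n2 := maxn n1 k; exists (scale_size n2) => N hN.
have bP n : (scale_size n <= N)%N -> (n <= N)%N.
  apply: leq_trans; rewrite (leq_trans _ (leq_addr _ _)) // mulnAC leq_pmull //.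
  by rewrite muln_gt0 q_gt0.
have exP : exists n, (scale_size n <= N)%N by exists n2.
(* The scale attached to [N] is the largest one whose blocks fit below [N]. *)
case: (ex_maxnP exP bP) => n hn nmax.
have n2n : (n2 <= n)%N by exact: nmax.
have Nn : (N < scale_size n.+1)%N.
  by rewrite ltnNge; apply/negP => /nmax; rewrite ltnn.
exists n; first by rewrite (leq_trans _ n2n) // leq_maxr.
have /not_orP[hrun hcr] : ~ bad_scale n w by apply: hn1; rewrite (leq_trans _ n2n) // leq_maxl.
split; last by move=> y yN; apply: not_crowded hcr; exact: ltn_trans Nn.
have [i iM hi] : exists2 i, (i < num_blocks n)%N &
    all_in X (G n) (iota (2 + i * (q * n)) (q * n)) w.
  apply: contrapT => hno; apply: hrun => i /= iM hall; apply: hno; by exists i.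
exists (i * (q * n))%N; split.
  apply: leq_trans hn; rewrite -mulSnr /scale_size addn2 ltnW // !ltnS mulnC.
  by rewrite leq_mul2l iM orbT.
move=> j j1 j2; apply: hi; rewrite /= mem_iota.
by move: j1 j2; clear; lia.
Qed.

End Scales.

Lemma sum_card_ge (R : realFieldType) l m (F : 'I_l -> R) (S : pred 'I_l) (t : R) :
  (forall j, 0 <= F j) -> (forall j, ~~ S j -> t <= F j) -> 0 <= t ->
  (#|S| < m <= l)%N -> (l - m).+1%:R * t <= \sum_j F j.
Proof.
move=> F0 Ft t0 /andP[Sm ml].
rewrite (bigID S) /= -[leLHS]add0r lerD ?sumr_ge0 //.
apply: (@le_trans _ _ (\sum_(j | ~~ S j) t)); last exact: ler_sum.
rewrite sumr_const -[leRHS]mulr_natl ler_wpM2r // ler_nat.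
have -> : #|(fun j => ~~ S j)| = (l - #|S|)%N.
  have := cardC S; rewrite card_ord => /(congr1 (subn^~ #|S|)) /=.
  by rewrite addKn => <-; apply: eq_card.
by move: Sm ml; clear; lia.
Qed.

Lemma sum_window (R : realType) (F : nat -> R) y l :
  \sum_(y.+2 <= e < (y.+1 + l).+1) F e = \sum_(j < l) F (y + 2 + j)%N.
Proof.
rewrite -{1}[y.+2]add0n big_addn.
have -> : ((y.+1 + l).+1 - y.+2 = l)%N by lia.
by rewrite big_mkord; apply: eq_bigr => i _; congr F; lia.
Qed.

(** For the Bernoulli law only windows made entirely of ones are bad, so the union over subsets
    costs no exponential factor. *)
Lemma card_pred_full l : (#|[pred S : {set 'I_l} | (l <= #|S|)%N]| <= 1)%N.
Proof.
apply/card_le1_eqP => S S'; rewrite !inE => hS hS'.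
have full (U : {set 'I_l}) : (l <= #|U|)%N -> U = [set: 'I_l]%SET.
  move=> hU; apply/eqP; rewrite eqEcard finset.subsetT /= cardsT card_ord //.
by rewrite (full S) // (full S').
Qed.

(** For the uniform law, the number of positions and subsets, times the [2 ^ n] for the geometric
    rate, has to be beaten by [(n ^ 2) ^ ((q + 3) * n)], the inverse probability of crowding. The
    powers of [n] leave a surplus of about [n ^ (4 n)]. *)
Lemma superexponential_bound q n : (0 < q)%N -> ((4 * q ^ 3) ^ q.+1 * 2 ^ (q + 5) <= n)%N ->
  (q * n.+1 * (q ^ 3 * n.+1 ^ 2) ^ (q.+1 * n.+1) * 2 ^ ((q + 4) * n) * 2 ^ n
   <= 2 * q * (4 * q ^ 3) ^ q.+1 * (n ^ 2) ^ ((q + 3) * n))%N.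
Proof.
set D := (_ * _)%N => q0 Dn.
have qn : (q < n)%N.
  apply: leq_trans Dn; apply: (@leq_trans (2 ^ q.+1)); first exact/ltnW/ltn_expl.
  by rewrite /D -[leqLHS]mul1n leq_mul // ?expn_gt0 ?muln_gt0 ?q0 // leq_exp2l //; lia.
have n0 : (0 < n)%N by lia.
have h1 : (q * n.+1 <= 2 * q * n)%N by rewrite mulnAC [(q * _)%N]mulnC leq_mul2r; lia.
have h2 : ((q ^ 3 * n.+1 ^ 2) ^ (q.+1 * n.+1) <= (4 * q ^ 3 * n ^ 2) ^ (q.+1 * n.+1))%N.
  rewrite leq_exp2r ?muln_gt0 // [(4 * _)%N]mulnC -mulnA leq_mul2l.
    by rewrite -[4%N]/(2 ^ 2)%N -expnMn leq_exp2r //; apply/orP; right; move: n0; clear; lia.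
(* [D ^ n] collects every purely exponential factor, and a part of the surplus absorbs it. *)
have h3 : (D ^ n <= n ^ n)%N by rewrite leq_exp2r.
have h4 : (n * n ^ n * n ^ (2 * (q.+1 * n.+1)) <= n ^ (2 * ((q + 3) * n)))%N.
  rewrite -expnS -expnD leq_pexp2l //.
  have -> : (2 * (q.+1 * n.+1) = 2 * (q * n) + 2 * n + 2 * q + 2)%N by clear; lia.
  have -> : (2 * ((q + 3) * n) = 2 * (q * n) + 6 * n)%N by clear; lia.
  by move: qn; clear; lia.
apply: (@leq_trans (2 * q * n * (4 * q ^ 3 * n ^ 2) ^ (q.+1 * n.+1) * 2 ^ ((q + 4) * n) * 2 ^ n)).
  by rewrite !leq_mul2r leq_mul // !orbT.
have -> : (2 * q * n * (4 * q ^ 3 * n ^ 2) ^ (q.+1 * n.+1) * 2 ^ ((q + 4) * n) * 2 ^ n =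
   2 * q * (4 * q ^ 3) ^ q.+1 * (D ^ n * n * n ^ (2 * (q.+1 * n.+1))))%N.
  rewrite /D !expnMn -!expnM.
  have -> : (q.+1 * n.+1 = q.+1 + q.+1 * n)%N by rewrite mulnS.
  have -> : ((q + 5) * n = (q + 4) * n + n)%N by clear; lia.
  rewrite -!mulnA; move: (q.+1 * n)%N ((q + 4) * n)%N q.+1 => B E A.
  by rewrite !mulnDr !expnD; ring.
rewrite leq_mul2l -expnM; apply/orP; right.
apply: leq_trans h4; rewrite leq_mul2r; apply/orP; right.
by rewrite mulnC leq_mul2l h3 orbT.
Qed.

(** * Almost sure convergence *)

Section AlmostSure.
Context (R : realType) (d : measure_display) (T : measurableType d)
  (P : probability T R).

Lemma ae_of_prob1 (A : set T) : measurable A -> P A = 1%E -> {ae P, forall w, A w}.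
Proof.
move=> mA PA; exists (~` A); split => //; first exact: measurableC.
by rewrite probability_setC // PA subee.
Qed.

Lemma ae_support (a : R) (X : nat -> {RV P >-> R}) :
  (forall j, (2 <= j)%N -> P (X j @^-1` `[a, 1]) = 1%E) ->
  {ae P, forall w, forall j, (2 <= j)%N -> a <= X j w <= 1}.
Proof.
move=> supp; apply: ae_foralln => j.
have [j2|j2] := leqP 2 j; last by apply: aeW => w; lia.
have := ae_of_prob1 _ (supp j j2); move=> /(_ _)/wrap[].
  by apply: measurable_funPTI; exact: measurable_itv.
by apply: filterS => w /=; rewrite in_itv.
Qed.

Lemma ae_cvg_of_scales (a : R) (a_ge0 : 0 <= a) (a_lt1 : a < 1)
  (X : nat -> {RV P >-> R}) :
  (forall j, (2 <= j)%N -> P (X j @^-1` `[a, 1]) = 1%E) ->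
  (forall q, (0 < q)%N -> {ae P, forall w, exists N0, forall N, (N0 <= N)%N ->
     exists2 n, (0 < n)%N & has_free_run (fun j => X j w) q n N /\
       all_windows_blocked (fun j => X j w) (1 - a) q n N}) ->
  {ae P, forall w, landscape_product (fun j => X j w) N @[N --> \oo]
          --> (pi ^+ 2 / 8 : R)}.
Proof.
move=> supp scales.
have aeq q := scales q.+1 (ltn0Sn q).
apply: filterS2 (ae_support supp) (ae_foralln aeq) => w hS hq.
(* The value 1 at the indices 0 and 1 extends the bounds [0 <= c <= 1] to all indices without
   changing the matrices. *)
pose c j := if (2 <= j)%N then X j w else 1.
have cE j : (2 <= j)%N -> c j = X j w by rewrite /c => ->.
have c0 j : 0 <= c j.
  by rewrite /c; case: ifP => // /hS /andP[h _]; exact: le_trans h.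
have c1 j : c j <= 1 by rewrite /c; case: ifP => // /hS /andP[_ h].
have lpE N : landscape_product (fun j => X j w) N = landscape_product c N.
  rewrite /landscape_product (@eq_hopping_matrix _ _ c) // => j j2.
  by rewrite cE.
under eq_fun do rewrite lpE.
apply/cvgrPdist_le => e e0.
have b0 : 0 < 1 - a by rewrite subr_gt0.
have [q q0 hlim] := landscape_product_near_limit b0 e0.
have := hq q.-1; rewrite prednK // => -[N0 hN0].
exists N0 => // N /= N0N; have [n n0 [[i [iN run]] win]] := hN0 N N0N.
apply: (hlim n N) => //.
  by exists i; split => // j j1 j2; rewrite cE; [exact: run | lia].
move=> y y0 yl; rewrite (le_trans (win y y0 yl)) //.
by apply: ler_sum_nat => j /andP[j1 _]; rewrite cE //; lia.
Qed.

End AlmostSure.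

(** * The Bernoulli and uniform laws *)

Section Main.
Context (R : realType) (d : measure_display) (T : measurableType d)
  (P : probability T R) (a : R) (a_ge0 : 0 <= a) (a_lt1 : a < 1)
  (X : nat -> {RV P >-> R}).
Hypothesis X_iid : iid_from2 X.
Hypothesis X_supp : forall j, (2 <= j)%N -> P (X j @^-1` `[a, 1]) = 1%E.

(** Free means equal to 1, and a window is crowded only when all its edges are 1. Any other window
    has an edge equal to [a], which alone contributes [1 - a]. *)
Lemma bernoulli_cvg (p : R) : 0 < p -> p < 1 ->
  (forall j, (2 <= j)%N -> bernoulli_law a p (X j)) ->
  {ae P, forall w, landscape_product (fun j => X j w) N @[N --> \oo]
          --> (pi ^+ 2 / 8 : R)}.
Proof.
move=> p0 p1 law.
have mX (x : R) j : measurable (X j @^-1` [set x]) by exact: measurable_funPTI.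
have ae_two : {ae P, forall w, forall j, (2 <= j)%N -> X j w = 1 \/ X j w = a}.
  apply: ae_foralln => j; have [j2|j2] := leqP 2 j; last by apply: aeW => w; lia.
  have [law1 lawa] := law j j2.
  have := @ae_of_prob1 R d T P (X j @^-1` [set 1] `|` X j @^-1` [set a]).
  move=> /(_ _ _)/wrap[||]; first exact: measurableU.
    rewrite measureU //.
      by rewrite [X in (X + _)%E]law1 [X in (_ + X)%E]lawa -EFinD addrC subrK.
    apply/seteqP; split => // w [/= -> /esym/eqP]; rewrite lt_eqF //.
  exact: filterS.
apply: (ae_cvg_of_scales a_ge0 a_lt1 X_supp) => q q0.
have rho01 : 0 < p < 1 by rewrite p0.
have C0 : 0 <= q%:R * p^-1 ^+ (q + 1) * (p * (1 - p))^-1.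
  have : 0 <= 1 - p by rewrite subr_ge0 ltW.
  by move=> ?; rewrite !mulr_ge0 ?exprn_ge0 ?invr_ge0 ?mulr_ge0 // ltW.
have hB n : (0 <= n)%N -> (q * n.+1)%:R * p^-1 ^+ ((q + 1) * n.+1)
    * (#|[pred S : {set 'I_((q + 4) * n)} | ((q + 4) * n <= #|S|)%N]|%:R * p ^+ ((q + 4) * n))
    <= q%:R * p^-1 ^+ (q + 1) * (p * (1 - p))^-1 * p ^+ n.
move=> _.
  have h1 : #|[pred S : {set 'I_((q + 4) * n)} | ((q + 4) * n <= #|S|)%N]|%:R
      * p ^+ ((q + 4) * n) <= p ^+ ((q + 4) * n).
    by rewrite ler_piMl ?exprn_ge0 ?(ltW p0) // -[leRHS]/(1%:R) ler_nat card_pred_full.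
  have q1 : 0 <= (q * n.+1)%:R * p^-1 ^+ ((q + 1) * n.+1).
    by rewrite mulr_ge0 // exprn_ge0 // invr_ge0 ltW.
  apply: le_trans (ler_wpM2l q1 h1) _.
  (* The excess of the window length [(q + 4) n] over [(q + 1) n] leaves three factors [p ^+ n]: one
     absorbs [n + 1] in [h2], one gives the geometric rate, and one is bounded by 1. *)
  have e : p^-1 ^+ ((q + 1) * n.+1) * p ^+ ((q + 4) * n) = p^-1 ^+ (q + 1) * (p ^+ n) ^+ 3.
    rewrite mulnS exprD -mulrA; congr (_ * _).
    have -> : ((q + 4) * n = (q + 1) * n + n * 3)%N by lia.
    by rewrite exprD [p ^+ (n * 3)]exprM mulrA exprVn mulVf ?mul1r // expf_neq0 // gt_eqF.
  rewrite -[leLHS]mulrA e natrM.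
  have pn0 : 0 < p ^+ n by rewrite exprn_gt0.
  have pn1 : p ^+ n <= 1 by rewrite exprn_ile1 // ltW.
  have h2 : n.+1%:R * p ^+ n <= (p * (1 - p))^-1.
    have : (1 - (1 - p)) ^+ n.+1 <= (n.+1%:R * (1 - p))^-1.
      by apply: expr1B_le_inv => //; rewrite subr_gt0 p1 /= lerBlDr lerDl ltW.
    rewrite subKr exprS !invfM => h2.
    rewrite -ler_pdivlMl ?ltr0n // mulrCA -ler_pdivrMl ?invr_gt0 // invrK //.
  have c0 : 0 <= q%:R * p^-1 ^+ (q + 1) by rewrite mulr_ge0 // exprn_ge0 // invr_ge0 ltW.
  have -> : q%:R * n.+1%:R * (p^-1 ^+ (q + 1) * (p ^+ n) ^+ 3) =
    q%:R * p^-1 ^+ (q + 1) * (n.+1%:R * p ^+ n * ((p ^+ n) * p ^+ n)) by ring.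
  rewrite -[leRHS]mulrA ler_wpM2l // ler_pM //.
  - by rewrite mulr_ge0 // ltW.
  - by rewrite mulr_ge0 // ltW.
  - by rewrite ler_piMl // ltW.
have m1 : forall n : nat, measurable ([set 1] : set R) by [].
have e1 : forall n : nat, P (X 2 @^-1` [set 1]) = p%:E by move=> _; exact: (law 2 isT).1.
have hg n : (0 <= n)%N -> 0 < p <= p by rewrite p0 lexx.
have hae := @ae_good_scales d T R P X X_iid q (fun=> [set 1]) (fun=> [set 1])
  (fun=> p) (fun=> p) (fun n => (q + 4) * n)%N q0 m1 m1 e1 e1 _ _ _ rho01 C0 hg hB.
apply: filterS3 (ae_support X_supp) ae_two hae => w hS hw /(_ 1%N)[N0 hN0].
exists N0 => N /hN0[n n0 [[i [iN run]] win]].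
exists n => //; split.
  by exists i; split => // j j1 j2; rewrite (run j j1 j2) subrr invr_ge0.
move=> y y0 yl; case: y y0 yl => // y _ yl.
rewrite sum_window.
have y2 (j : nat) : (2 <= y + 2 + j)%N by clear; lia.
have b0 : 0 <= 1 - a by rewrite subr_ge0 ltW.
apply: (@le_trans _ _ (((q + 4) * n - (q + 4) * n).+1%:R * (1 - a))).
  by rewrite subnn mul1r ler_pdivrMr ?ltr0n // ler_peMr // ler1n.
apply: (@sum_card_ge _ _ _ _ [pred j : 'I_((q + 4) * n) | X (y + 2 + j)%N w \in [set 1]]) => //.
- by move=> j; rewrite subr_ge0; have /andP[] := hS _ (y2 j).
- move=> j /= /negP hj; have [h|->//] := hw _ (y2 j).
  by case: hj; rewrite h; exact: mem_set.
- by rewrite leqnn andbT; apply: win; move: yl; clear; lia.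
Qed.

Lemma uniform_law_preimage (t : R) : uniform_law a_lt1 (X 2) -> 0 <= t <= 1 ->
  P (X 2 @^-1` `[1 - (1 - a) * t, 1]) = t%:E.
Proof.
move=> law /andP[t0 t1].
have b0 : 0 < 1 - a by rewrite subr_gt0.
have -> : P (X 2 @^-1` `[1 - (1 - a) * t, 1]) = distribution P (X 2) `[1 - (1 - a) * t, 1] by [].
rewrite law; last exact: measurable_itv.
rewrite /uniform_prob integral_uniform_pdf setIidl; last first.
  move=> x /=; rewrite !in_itv /= => /andP[h ->]; rewrite andbT (le_trans _ h) //.
  have : (1 - a) * t <= 1 - a by rewrite ler_piMr // ltW.
  lra.
rewrite (eq_integral (fun=> (1 - a)^-1%:E)); last first.
  move=> x; rewrite inE /= in_itv /= /uniform_pdf => /andP[h ->]; rewrite andbT ifT //.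
  rewrite (le_trans _ h) //.
  have : (1 - a) * t <= 1 - a by rewrite ler_piMr // ltW.
  lra.
rewrite integral_cst //= lebesgue_measure_itv /= lte_fin.
have [t0'|t0'] := eqVneq t 0.
  by rewrite t0' mulr0 subr0 ltxx mule0.
have tp : 0 < t by rewrite lt_def t0' t0.
rewrite ifT; last by rewrite gtrBl mulr_gt0.
by rewrite -EFinD -EFinM; congr (_%:E); field; rewrite gt_eqF.
Qed.

(** An edge fails to block when [1 - a_j] is at most [(1 - a) / n^2]. With fewer than [(q + 3) n]
    such edges in a window of length [(q + 4) n], more than [n] others remain, and they add up to at
    least [(1 - a) / n]. *)
Lemma uniform_cvg : (forall j, (2 <= j)%N -> uniform_law a_lt1 (X j)) ->
  {ae P, forall w, landscape_product (fun j => X j w) N @[N --> \oo]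
          --> (pi ^+ 2 / 8 : R)}.
Proof.
move=> law.
have b0 : 0 < 1 - a by rewrite subr_gt0.
apply: (ae_cvg_of_scales a_ge0 a_lt1 X_supp) => q q0.
pose g n : R := (q ^ 3 * n ^ 2)%:R^-1.
pose g' n : R := (n ^ 2)%:R^-1.
have inv01 k : 0 <= (k%:R^-1 : R) <= 1.
  rewrite invr_ge0 ler0n /=; case: k => [|k]; first by rewrite invr0.
  by rewrite invf_le1 ?ltr0n // ler1n.
pose D := ((4 * q ^ 3) ^ q.+1 * 2 ^ (q + 5))%N.
pose C := (2 * q * (4 * q ^ 3) ^ q.+1)%N.
have mI (x : nat -> R) (n : nat) : measurable `[1 - (1 - a) * x n, 1 : R] by exact: measurable_itv.
have hP (k : nat -> nat) n : P (X 2 @^-1` `[1 - (1 - a) * (k n)%:R^-1, 1]) = (k n)%:R^-1%:E.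
  by apply: uniform_law_preimage; [exact: law | exact: inv01].
have rho01 : 0 < (2^-1 : R) < 1.
  by rewrite invr_gt0 ltr0n invf_lt1 ?ltr0n // ltr1n.
(* The threshold combines the [D] of [superexponential_bound] with [n >= 2], which makes the free
   probability at most one half. *)
have hg n : (D + 2 <= n)%N -> 0 < g n <= 2^-1.
  move=> Dn; have n2 : (2 <= q ^ 3 * n ^ 2)%N.
    apply: (@leq_trans (n ^ 2)); last by rewrite leq_pmull // expn_gt0 q0.
    by apply: (@leq_trans n); [lia | rewrite -{1}[n]expn1 leq_pexp2l //; lia].
  by rewrite /g invr_gt0 ltr0n (ltn_trans _ n2) //=
    lef_pV2 ?posrE ?ltr0n ?(ltn_trans _ n2) // ler_nat.
have hB n : (D + 2 <= n)%N -> (q * n.+1)%:R * (g n.+1)^-1 ^+ ((q + 1) * n.+1)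
    * (#|[pred S : {set 'I_((q + 4) * n)} | ((q + 3) * n <= #|S|)%N]|%:R * g' n ^+ ((q + 3) * n))
    <= C%:R * 2^-1 ^+ n.
  move=> Dn; have n0 : (0 < n)%N by lia.
  have hcard : (#|[pred S : {set 'I_((q + 4) * n)} | ((q + 3) * n <= #|S|)%N]|
      <= 2 ^ ((q + 4) * n))%N.
    by rewrite (leq_trans (max_card _)) // -cardsT -powersetT card_powerset cardsT card_ord.
  have := @superexponential_bound q n q0 (leq_trans (leq_addr 2 D) Dn).
  rewrite -/C addn1 -(ler_nat R) => hb.
  rewrite /g /g' invrK !exprVn ler_pdivlMr ?exprn_gt0 //.
  have B0 : 0 < (n ^ 2)%:R ^+ ((q + 3) * n) :> R by rewrite exprn_gt0 // ltr0n expn_gt0 n0.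
  rewrite mulrA mulrAC ler_pdivrMr //.
  rewrite -!natrX -!natrM; apply: le_trans hb; rewrite ler_nat.
  by rewrite leq_mul2r leq_mul2l hcard !orbT.
have hae := @ae_good_scales d T R P X X_iid q _ _ g g' (fun n => (q + 3) * n)%N q0
  (mI g) (mI g') (hP (fun n => q ^ 3 * n ^ 2)%N) (hP (fun n => n ^ 2)%N)
  _ _ _ rho01 (ler0n _ C) hg hB.
apply: filterS2 (ae_support X_supp) hae => w hS /(_ 1%N)[N0 hN0].
exists N0 => N /hN0[n n0 [[i [iN run]] win]].
have gn0 k : 0 <= (k%:R^-1 : R) by rewrite invr_ge0.
exists n => //; split.
  exists i; split => // j j1 j2; have := run j j1 j2; rewrite /= in_itv /= => /andP[h _].
  have : (1 - a) * g n <= g n by apply: ler_piMl; [exact: gn0 | rewrite gerBl].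
  by rewrite -/(g n); lra.
move=> y y0 yl; case: y y0 yl => // y _ yl.
rewrite sum_window.
have y2 (j : nat) : (2 <= y + 2 + j)%N by clear; lia.
have l3 : ((q + 4) * n - (q + 3) * n = n)%N by rewrite -mulnBl subnDl mul1n.
have t0 : 0 <= (1 - a) * g' n by apply: mulr_ge0; [exact: ltW | exact: gn0].
apply: (@le_trans _ _ (((q + 4) * n - (q + 3) * n).+1%:R * ((1 - a) * g' n))).
  apply: (@le_trans _ _ (n%:R * ((1 - a) * g' n))); last by rewrite l3 ler_wpM2r // ler_nat.
  have np : 0 < n%:R :> R by rewrite ltr0n.
  by rewrite /g' natrX le_eqVlt; apply/orP; left; apply/eqP; field; rewrite gt_eqF.
apply: (@sum_card_ge _ _ _ _ [pred j : 'I_((q + 4) * n) |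
    X (y + 2 + j)%N w \in `[1 - (1 - a) * g' n, 1]%classic]) => //.
- by move=> j; rewrite subr_ge0; have /andP[] := hS _ (y2 j).
- move=> j /= /negP hj; have /andP[_ X1] := hS _ (y2 j).
  rewrite leNgt; apply/negP => hlt; apply: hj; apply: mem_set.
  by rewrite /= in_itv /= X1 andbT; lra.
- by rewrite win /=; [rewrite leq_mul2r leq_add2l orbT | move: yl; clear; lia].
Qed.

End Main.

Unset Implicit Arguments.

Theorem theorem2 (R : realType) (d : measure_display) (T : measurableType d)
  (P : probability T R) (a : R) (a_ge0 : 0 <= a) (a_lt1 : a < 1)
  (X : nat -> {RV P >-> R})
  (X_iid : iid_from2 X)
  (X_supp : forall j, (2 <= j)%N -> P (X j @^-1` `[a, 1]) = 1%E) :
  (forall p : R, 0 < p -> p < 1 ->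
     (forall j, (2 <= j)%N -> bernoulli_law a p (X j)) ->
     {ae P, forall w,
        landscape_product (fun j => X j w) N @[N --> \oo]
          --> (pi ^+ 2 / 8 : R)})
  /\
  ((forall j, (2 <= j)%N -> uniform_law a_lt1 (X j)) ->
     {ae P, forall w,
        let q := fun N => (landscape_product (fun j => X j w) N)%:E in
        [/\ (1 <= limn_einf q)%E,
            (limn_einf q <= limn_esup q)%E
          & (limn_esup q <= (pi ^+ 2 / 8)%:E)%E]}).
Proof.
split => [p p0 p1 law|law]; first exact: (bernoulli_cvg a_ge0 a_lt1 X_iid X_supp p0 p1 law).
apply: filterS (uniform_cvg a_ge0 X_iid X_supp law) => w lim_w.
set q := fun N => _.
have qlim : q @ \oo --> (pi ^+ 2 / 8 : R)%:E by apply: cvg_EFin lim_w; exact: nearW.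
have [-> ->] := cvg_limn_einf_sup qlim.
split => //; rewrite lee_fin.
by have := sqr_pi_ge8 (R := R); lra.
Qed.
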